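(* Work in $\mathrm{ZFU}$. Assume $\mathrm{SVC}$ (Small Violations of Choice). Then Plenitude$^+$ implies the Reflection Principle (RP).
   Context: $\mathrm{ZFU}$ is ZF set theory with urelements. Its language has $\in$ and a unary predicate $\mathscr{A}$ for urelements; $\mathscr{A}$ also denotes the class of all urelements. A set is an object that is not an urelement. The axioms are Foundation, Pairing, Union, Powerset, Infinity, the Separation schema, the Replacement schema (but not Collection), Extensionality for sets only, and the axiom that no urelement has members. The urelements may form a proper class. $x\sim y$ means there is a bijection between the sets $x$ and $y$; $x\preceq^* y$ means that there is a surjection from $y$ onto $x$ or $x=\emptyset$. Ordinals are transitive sets with no urelements in their transitive closure, well-ordered by $\in$. $\mathrm{SVC}(S)$, for a set $S$: for every set $x$ there is an ordinal $\alpha$ such that $x\preceq^* S\times\alpha$. $\mathrm{SVC}$: there is a set $S$ such that $\mathrm{SVC}(S)$. Plenitude$^+$: for every set $x$ there is a set $A$ of urelements with $x\sim A$. RP (schema, for each formula $\varphi$): for every set $x$ there is a transitive set $t$ with $x\subseteq t$ such that for all $x_1,\dots,x_n\in t$, $\varphi(x_1,\dots,x_n)\leftrightarrow\varphi^t(x_1,\dots,x_n)$, where $\varphi^t$ is the relativization of $\varphi$ to $t$. *)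

(* Defs.v *)
(** ** The language and its structures *)

(** [ur] is the predicate for urelements; equality is interpreted as identity. *)
Record structure := Structure {
  carrier :> Type;
  mem : carrier -> carrier -> Prop;
  ur : carrier -> Prop
}.

Arguments mem {s} _ _.
Arguments ur {s} _.

Declare Scope zfu_scope.
Delimit Scope zfu_scope with zfu.
Open Scope zfu_scope.
Notation "x ∈ y" := (mem x y) (at level 70, no associativity) : zfu_scope.

(** First-order formulas with de Bruijn indices: [fAll] binds index 0. The
    connectives listed are adequate, satisfaction being used classically. *)
Inductive formula : Type :=
  | fEq (i j : nat)
  | fMem (i j : nat)
  | fUr (i : nat)
  | fBot
  | fImp (p q : formula)
  | fAll (p : formula).

Definition scons {X : Type} (x : X) (e : nat -> X) : nat -> X :=
  fun i => match i with O => x | S j => e j end.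
Notation "x .: e" := (scons x e) (at level 55, right associativity) : zfu_scope.

Fixpoint sat {M : structure} (e : nat -> M) (p : formula) : Prop :=
  match p with
  | fEq i j => e i = e j
  | fMem i j => e i ∈ e j
  | fUr i => ur (e i)
  | fBot => False
  | fImp p q => sat e p -> sat e q
  | fAll p => forall x : M, sat (x .: e) p
  end.

Fixpoint free (i : nat) (p : formula) : Prop :=
  match p with
  | fEq j k | fMem j k => i = j \/ i = k
  | fUr j => i = j
  | fBot => False
  | fImp p q => free i p \/ free i q
  | fAll p => free (S i) p
  end.

(** [relativize 0 p] is p^t, where t is a fresh variable inserted at index 0 and
    every free variable of p is shifted up by one. In general [k] is the index
    of t, that is, the number of quantifiers crossed so far. *)
Definition lift (k i : nat) : nat := if Nat.ltb i k then i else S i.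

Fixpoint relativize (k : nat) (p : formula) : formula :=
  match p with
  | fEq i j => fEq (lift k i) (lift k j)
  | fMem i j => fMem (lift k i) (lift k j)
  | fUr i => fUr (lift k i)
  | fBot => fBot
  | fImp p q => fImp (relativize k p) (relativize k q)
  | fAll p => fAll (fImp (fMem 0 (S k)) (relativize (S k) p))
  end.

(** ** Notions expressed in the language

    All quantifiers below range over the structure, so that each definition is
    the satisfaction of a first-order formula. *)

Definition is_set {M : structure} (x : M) : Prop := ~ ur x.

Definition is_empty {M : structure} (x : M) : Prop :=
  is_set x /\ forall z : M, ~ z ∈ x.

Definition subset {M : structure} (x y : M) : Prop :=
  forall z : M, z ∈ x -> z ∈ y.
Notation "x ⊆ y" := (subset x y) (at level 70, no associativity) : zfu_scope.

Definition transitive {M : structure} (x : M) : Prop :=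
  forall y z : M, y ∈ x -> z ∈ y -> z ∈ x.

Definition is_pair {M : structure} (p x y : M) : Prop :=
  is_set p /\ forall z : M, z ∈ p <-> z = x \/ z = y.

(** Kuratowski pair. *)
Definition is_opair {M : structure} (p x y : M) : Prop :=
  exists a b : M, is_pair a x x /\ is_pair b x y /\ is_pair p a b.

Definition is_product {M : structure} (p x y : M) : Prop :=
  is_set p /\
  forall z : M, z ∈ p <-> exists u v : M, u ∈ x /\ v ∈ y /\ is_opair z u v.

Definition app {M : structure} (f u v : M) : Prop :=
  exists p : M, p ∈ f /\ is_opair p u v.

Definition is_function {M : structure} (f x y : M) : Prop :=
  is_set f /\
  (forall p : M, p ∈ f -> exists u v : M, u ∈ x /\ v ∈ y /\ is_opair p u v) /\
  (forall u : M, u ∈ x -> exists! v : M, app f u v).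

Definition is_surjection {M : structure} (f x y : M) : Prop :=
  is_function f x y /\ forall v : M, v ∈ y -> exists u : M, app f u v.

Definition is_bijection {M : structure} (f x y : M) : Prop :=
  is_surjection f x y /\
  forall u u' v : M, app f u v -> app f u' v -> u = u'.

Definition equinumerous {M : structure} (x y : M) : Prop :=
  exists f : M, is_bijection f x y.

(** x ≼* y *)
Definition surj_le {M : structure} (x y : M) : Prop :=
  (exists f : M, is_surjection f y x) \/ is_empty x.

Definition in_trcl {M : structure} (y x : M) : Prop :=
  forall t : M, is_set t -> transitive t -> x ⊆ t -> y ∈ t.

Definition well_ordered_by_mem {M : structure} (x : M) : Prop :=
  (forall a : M, a ∈ x -> ~ a ∈ a) /\
  (forall a b c : M, a ∈ x -> b ∈ x -> c ∈ x -> a ∈ b -> b ∈ c -> a ∈ c) /\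
  (forall a b : M, a ∈ x -> b ∈ x -> a ∈ b \/ a = b \/ b ∈ a) /\
  (forall s : M, is_set s -> s ⊆ x -> (exists a : M, a ∈ s) ->
     exists m : M, m ∈ s /\ forall a : M, a ∈ s -> m = a \/ m ∈ a).

Definition is_ordinal {M : structure} (a : M) : Prop :=
  is_set a /\ transitive a /\
  (forall y : M, in_trcl y a -> is_set y) /\
  well_ordered_by_mem a.

(** ** The axioms of ZFU *)

Definition Foundation (M : structure) : Prop :=
  forall x : M, (exists y : M, y ∈ x) ->
    exists y : M, y ∈ x /\ forall z : M, z ∈ x -> ~ z ∈ y.

Definition Pairing (M : structure) : Prop :=
  forall x y : M, exists p : M, is_pair p x y.

Definition Union (M : structure) : Prop :=
  forall x : M, is_set x -> exists u : M, is_set u /\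
    forall z : M, z ∈ u <-> exists y : M, y ∈ x /\ z ∈ y.

Definition Powerset (M : structure) : Prop :=
  forall x : M, is_set x -> exists p : M, is_set p /\
    forall z : M, z ∈ p <-> is_set z /\ z ⊆ x.

Definition Infinity (M : structure) : Prop :=
  exists s : M, is_set s /\
    (exists o : M, is_empty o /\ o ∈ s) /\
    (forall x : M, x ∈ s -> exists y : M, y ∈ s /\ is_set y /\
       forall z : M, z ∈ y <-> z ∈ x \/ z = x).

(** In the two schemas the environment [e] supplies the parameters. *)

Definition Separation (M : structure) : Prop :=
  forall (p : formula) (e : nat -> M) (x : M), is_set x ->
    exists y : M, is_set y /\ forall z : M, z ∈ y <-> z ∈ x /\ sat (z .: e) p.

Definition Replacement (M : structure) : Prop :=
  forall (p : formula) (e : nat -> M) (x : M), is_set x ->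
    (forall u : M, u ∈ x -> exists! v : M, sat (u .: v .: e) p) ->
    exists y : M, is_set y /\
      forall v : M, v ∈ y <-> exists u : M, u ∈ x /\ sat (u .: v .: e) p.

Definition Extensionality (M : structure) : Prop :=
  forall x y : M, is_set x -> is_set y ->
    (forall z : M, z ∈ x <-> z ∈ y) -> x = y.

Definition Urelements_memberless (M : structure) : Prop :=
  forall a x : M, ur a -> ~ x ∈ a.

Record ZFU (M : structure) : Prop := {
  zfu_foundation : Foundation M;
  zfu_pairing : Pairing M;
  zfu_union : Union M;
  zfu_powerset : Powerset M;
  zfu_infinity : Infinity M;
  zfu_separation : Separation M;
  zfu_replacement : Replacement M;
  zfu_extensionality : Extensionality M;
  zfu_urelements : Urelements_memberless M
}.

(** ** SVC, Plenitude^+ and reflection *)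

Definition SVC_for {M : structure} (s : M) : Prop :=
  forall x : M, is_set x ->
    exists a p : M, is_ordinal a /\ is_product p s a /\ surj_le x p.

Definition SVC (M : structure) : Prop :=
  exists s : M, is_set s /\ SVC_for s.

Definition Plenitude_plus (M : structure) : Prop :=
  forall x : M, is_set x ->
    exists A : M, is_set A /\ (forall a : M, a ∈ A -> ur a) /\ equinumerous x A.

Definition RP_for (M : structure) (p : formula) : Prop :=
  forall x : M, is_set x ->
    exists t : M, is_set t /\ transitive t /\ x ⊆ t /\
      forall e : nat -> M, (forall i : nat, free i p -> e i ∈ t) ->
        (sat e p <-> sat (t .: e) (relativize 0 p)).

Definition RP (M : structure) : Prop := forall p : formula, RP_for M p.

(* Main.v *)
From Stdlib Require Import Arith Lia ClassicalEpsilon FunctionalExtensionality PropExtensionality.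
Require Import Defs.

(** The idea is to build a transitive set in which every true existential
    subformula of [p] with parameters in the set has a witness in the set; the
    Tarski-Vaught argument ([tarski_vaught_reflects]) then gives reflection.
    Without Collection one cannot simply gather witnesses, because their
    urelements may be spread over a proper class. What saves the argument is that
    urelements are interchangeable.

    Let [A] be a set of urelements over which the given set is built. By SVC every
    set injects into [code a], the power set of [S0 × a], for some ordinal [a];
    so the urelements that a witness needs besides those of its parameters can be
    measured by an ordinal, and so can its rank. Put [index a = a × code a], take a
    one-to-one family [g] of urelements off [A] indexed by [index a], and let
    [stage A g a] be the [a]-th level of the cumulative hierarchy over [A] and the
    values of [g] on [index a].

    A permutation of urelements extends to an automorphism of the universe, and
    automorphisms preserve truth. Plenitude⁺ always provides a further disjoint copy
    of any set of urelements, so any two families with the same index set are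
    exchanged by an automorphism fixing a prescribed set of urelements
    ([homogeneity]). This has two effects.

    - How far one must go to find witnesses for parameters in [stage A g a] does not
      depend on [g]: a bound found for one family, by Replacement over the set of
      parameters, is a bound for all of them.
    - A witness whose additional urelements inject into [code c] can be moved, with
      the parameters fixed, so that these urelements become values of [g] on
      [{c} × code c]; this part of the index set is disjoint from [index a] as soon
      as [a ⊆ c], so there is room for them.

    Hence there is a definable relation between ordinals [a] and [b], not mentioning
    any [g], which says that all required witnesses for [stage A g a] occur in
    [stage A g b], and every [a] has such a [b] ([witnesses_bounded_total]). Only
    ordinals have been chosen so far, and they can be chosen least; so one can
    iterate ω times inside the model and get an ordinal [l] closed under this
    relation ([closed_ordinal]). A single family [g] on [index l] is chosen at the
    very end, and the union of [stage A g a] for [a] in [l] is the required set.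

    The schemas of the theory speak about formulas, so everything above has to be
    definable over the model. The first part sets up a notion of definable predicate
    on environments that is closed under the usual constructions and can be checked
    automatically. *)

Section Model.

Context (M : structure) (ZF : ZFU M).

(** * Definability with parameters *)

Notation env := (nat -> M).

Fixpoint rename (r : nat -> nat) (p : formula) : formula :=
  match p with
  | fEq i j => fEq (r i) (r j)
  | fMem i j => fMem (r i) (r j)
  | fUr i => fUr (r i)
  | fBot => fBot
  | fImp p q => fImp (rename r p) (rename r q)
  | fAll p => fAll (rename (fun i => match i with O => O | S j => S (r j) end) p)
  end.

Lemma sat_rename (p : formula) : forall (r : nat -> nat) (e : env),
  sat e (rename r p) <-> sat (fun i => e (r i)) p.
Proof.
  induction p as [i j|i j|i| |p IHp q IHq|p IHp]; intros r e; simpl; try tauto.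
  - rewrite IHp, IHq. tauto.
  - split; intros H x; specialize (H x).
    + apply IHp in H. replace (x .: fun i => e (r i)) with
        (fun i => (x .: e) (match i with O => O | S j => S (r j) end)); auto.
      extensionality i; destruct i; reflexivity.
    + apply IHp. replace (fun i => (x .: e) (match i with O => O | S j => S (r j) end))
        with (x .: fun i => e (r i)); auto.
      extensionality i; destruct i; reflexivity.
Qed.

Lemma sat_ext (p : formula) : forall e e' : env,
  (forall i, free i p -> e i = e' i) -> (sat e p <-> sat e' p).
Proof.
  induction p as [i j|i j|i| |p IHp q IHq|p IHp]; intros e e' H; simpl in *; try tauto.
  - rewrite (H i), (H j); tauto.
  - rewrite (H i), (H j); tauto.
  - rewrite (H i); tauto.
  - rewrite (IHp e e'), (IHq e e'); auto; tauto.
  - split; intros Hs x; (eapply IHp; [|apply (Hs x)]); intros [|i] Hi; simpl; auto.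
    symmetry; auto.
Qed.

(** Each variable of a formula is assigned either a variable of the environment or
    a parameter from the model. Keeping parameters in the assignment, and not in a
    fixed part of the environment, makes every element of [M] usable as a constant. *)
Definition slot (s : nat -> nat + M) (e : env) : env :=
  fun i => match s i with inl j => e j | inr a => a end.

Definition definable (P : env -> Prop) : Prop :=
  exists (p : formula) (s : nat -> nat + M), forall e, sat (slot s e) p <-> P e.

(** A function of the environment is definable when its graph is; variable [0] holds
    the value. *)
Definition definable_term (t : env -> M) : Prop := definable (fun e => e 0 = t (fun i => e (S i))).

Lemma dfn_ext (P Q : env -> Prop) : (forall e, P e <-> Q e) -> definable P -> definable Q.
Proof.
  intros H (p & s & Hp). exists p, s. intros e. rewrite Hp. apply H.
Qed.

Lemma dfn_sat (p : formula) : definable (fun e => sat e p).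
Proof. exists p, inl. intros e. reflexivity. Qed.

(** Instantiating variables by other variables or by constants composes the two
    slot assignments. *)
Lemma dfn_inst (P : env -> Prop) (s : nat -> nat + M) :
  definable P -> definable (fun e => P (slot s e)).
Proof.
  intros (p & s0 & Hp).
  exists p, (fun i => match s0 i with inl j => s j | inr a => inr a end).
  intros e. rewrite <- Hp. unfold slot. apply sat_ext. intros i _. destruct (s0 i); reflexivity.
Qed.

Lemma dfn_rename (P : env -> Prop) (r : nat -> nat) :
  definable P -> definable (fun e => P (fun i => e (r i))).
Proof. exact (dfn_inst P (fun i => inl (r i))). Qed.

Lemma dfn_False : definable (fun _ => False).
Proof. exists fBot, inl. intros e. simpl. tauto. Qed.

(** The two formulas come with different slot assignments; giving the even variables
    to one and the odd ones to the other makes the assignments compatible. *)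
Lemma dfn_imp (P Q : env -> Prop) : definable P -> definable Q -> definable (fun e => P e -> Q e).
Proof.
  intros (p & s & Hp) (q & s' & Hq).
  exists (fImp (rename (fun i => 2 * i) p) (rename (fun i => S (2 * i)) q)),
    (fun i => if Nat.even i then s (Nat.div2 i) else s' (Nat.div2 i)).
  intros e. cbn [sat]. rewrite !sat_rename.
  rewrite <- Hp, <- Hq. unfold slot.
  assert (E1 : forall i, Nat.even (2 * i) = true).
  { intros i. apply Nat.even_spec. exists i. lia. }
  assert (E2 : forall i, Nat.even (S (2 * i)) = false).
  { intros i. rewrite Nat.even_succ, <- Nat.negb_even, E1. reflexivity. }
  rewrite (sat_ext p (fun i => match (if Nat.even (2 * i) then _ else _) with inl j => _ | inr a => _ end)
     (fun i => match s i with inl j => e j | inr a => a end)).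
  2:{ intros i _. rewrite E1, Nat.div2_double. reflexivity. }
  rewrite (sat_ext q (fun i => match (if Nat.even (S (2 * i)) then _ else _) with inl j => _ | inr a => _ end)
     (fun i => match s' i with inl j => e j | inr a => a end)).
  2:{ intros i _. rewrite E2, Nat.div2_succ_double. reflexivity. }
  tauto.
Qed.

(** The variables assigned to the quantified slot are renamed to the bound variable
    [0], all others are shifted past it. *)
Lemma dfn_all (P : env -> M -> Prop) :
  definable (fun e => P (fun i => e (S i)) (e 0)) -> definable (fun e => forall x, P e x).
Proof.
  intros (p & s & Hp).
  exists (fAll (rename (fun i => match s i with inl O => O | _ => S i end) p)),
    (fun i => match s i with inl (S j) => inl j | r => r end).
  intros e. cbn [sat].
  assert (E : forall x, sat (x .: slot (fun i => match s i with inl (S j) => inl j | r => r end) e)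
    (rename (fun i => match s i with inl O => O | _ => S i end) p) <-> P e x).
  { intros x. rewrite sat_rename. rewrite <- (Hp (x .: e)).
    apply sat_ext. intros i _. unfold slot. destruct (s i) as [[|j]|a] eqn:Hs; simpl; try rewrite Hs; reflexivity. }
  split; intros H x; apply E, H.
Qed.

Lemma dfn_not (P : env -> Prop) : definable P -> definable (fun e => ~ P e).
Proof. intros H. exact (dfn_imp _ _ H dfn_False). Qed.

Lemma dfn_and (P Q : env -> Prop) : definable P -> definable Q -> definable (fun e => P e /\ Q e).
Proof.
  intros HP HQ. apply (dfn_ext (fun e => ~ (P e -> ~ Q e))).
  - intros e. destruct (classic (P e)), (classic (Q e)); tauto.
  - apply dfn_not, dfn_imp; [|apply dfn_not]; assumption.
Qed.

Lemma dfn_or (P Q : env -> Prop) : definable P -> definable Q -> definable (fun e => P e \/ Q e).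
Proof.
  intros HP HQ. apply (dfn_ext (fun e => ~ P e -> Q e)).
  - intros e. destruct (classic (P e)), (classic (Q e)); tauto.
  - apply dfn_imp; [apply dfn_not|]; assumption.
Qed.

Lemma dfn_iff (P Q : env -> Prop) : definable P -> definable Q -> definable (fun e => P e <-> Q e).
Proof. intros HP HQ. apply dfn_and; apply dfn_imp; assumption. Qed.

Lemma dfn_ex (P : env -> M -> Prop) :
  definable (fun e => P (fun i => e (S i)) (e 0)) -> definable (fun e => exists x, P e x).
Proof.
  intros H. apply (dfn_ext (fun e => ~ forall x, ~ P e x)).
  - intros e. split.
    + intros N. destruct (classic (exists x, P e x)) as [|N']; [assumption|].
      destruct N. intros x Hx. apply N'. exists x. exact Hx.
    + intros [x Hx] N. exact (N x Hx).
  - apply dfn_not, dfn_all, dfn_not, H.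
Qed.

Lemma dfn_const (A : Prop) : definable (fun _ => A).
Proof.
  destruct (classic A).
  - apply (dfn_ext (fun _ => ~ False)); [tauto|]. apply dfn_not, dfn_False.
  - apply (dfn_ext (fun _ => False)); [tauto|]. apply dfn_False.
Qed.

Lemma dfn_let (P : env -> M -> Prop) (t : env -> M) :
  definable_term t -> definable (fun e => P (fun i => e (S i)) (e 0)) -> definable (fun e => P e (t e)).
Proof.
  intros Ht HP. apply (dfn_ext (fun e => exists x, x = t e /\ P e x)).
  - intros e. split.
    + intros (x & -> & H). exact H.
    + intros H. exists (t e). auto.
  - apply dfn_ex, dfn_and; assumption.
Qed.

Lemma dt_weaken (t : env -> M) : definable_term t -> definable_term (fun e => t (fun i => e (S i))).
Proof.
  intros H. exact (dfn_rename _ (fun i => match i with O => O | S j => S (S j) end) H).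
Qed.

Lemma dfn_let2 (P : M -> M -> Prop) (s t : env -> M) :
  definable (fun e => P (e 0) (e 1)) -> definable_term s -> definable_term t -> definable (fun e => P (s e) (t e)).
Proof.
  intros HP Hs Ht. apply (dfn_let (fun e y => P (s e) y)); [assumption|].
  apply (dfn_let (fun e x => P x (e 0))); [apply dt_weaken; assumption|].
  exact HP.
Qed.

Lemma dfn_let1 (P : M -> Prop) (s : env -> M) :
  definable (fun e => P (e 0)) -> definable_term s -> definable (fun e => P (s e)).
Proof.
  intros HP Hs. apply (dfn_let (fun _ x => P x)); assumption.
Qed.

Lemma dfn_eq (s t : env -> M) : definable_term s -> definable_term t -> definable (fun e => s e = t e).
Proof.
  apply (dfn_let2 (fun x y => x = y)). exact (dfn_sat (fEq 0 1)).
Qed.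

Lemma dfn_mem (s t : env -> M) : definable_term s -> definable_term t -> definable (fun e => s e ∈ t e).
Proof.
  apply (dfn_let2 (fun x y => x ∈ y)). exact (dfn_sat (fMem 0 1)).
Qed.

Lemma dfn_ur (s : env -> M) : definable_term s -> definable (fun e => ur (s e)).
Proof. apply (dfn_let1 (fun x => ur x)). exact (dfn_sat (fUr 0)). Qed.

Lemma dt_var (i : nat) : definable_term (fun e => e i).
Proof. exact (dfn_sat (fEq 0 (S i))). Qed.

Lemma dt_const (a : M) : definable_term (fun _ => a).
Proof.
  exists (fEq 0 1), (fun i => match i with O => inl 0 | _ => inr a end). intros e. reflexivity.
Qed.

Lemma dt_rename (t : env -> M) (r : nat -> nat) : definable_term t -> definable_term (fun e => t (fun i => e (r i))).
Proof.
  intros H. exact (dfn_rename _ (fun i => match i with O => O | S j => S (r j) end) H).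
Qed.

Lemma dt_let (t : env -> M -> M) (s : env -> M) :
  definable_term (fun e => t (fun i => e (S i)) (e 0)) -> definable_term s -> definable_term (fun e => t e (s e)).
Proof.
  intros Ht Hs.
  apply (dfn_let (fun e x => e 0 = t (fun i => e (S i)) x)); [apply dt_weaken; assumption|].
  exact (dfn_rename _ (fun i => match i with O => 1 | S O => O | S j => S j end) Ht).
Qed.

Definition definable_fun1 (F : M -> M) : Prop := definable_term (fun e => F (e 0)).
Definition definable_fun2 (F : M -> M -> M) : Prop := definable_term (fun e => F (e 0) (e 1)).
Definition definable_fun3 (F : M -> M -> M -> M) : Prop := definable_term (fun e => F (e 0) (e 1) (e 2)).
Definition definable1 (P : M -> Prop) : Prop := definable (fun e => P (e 0)).
Definition definable2 (P : M -> M -> Prop) : Prop := definable (fun e => P (e 0) (e 1)).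

Lemma dt_app1 (F : M -> M) : definable_fun1 F -> forall s, definable_term s -> definable_term (fun e => F (s e)).
Proof.
  intros HF s Hs. exact (dt_let (fun e x => F x) s HF Hs).
Qed.

Lemma dt_app2 (F : M -> M -> M) : definable_fun2 F -> forall s t, definable_term s -> definable_term t -> definable_term (fun e => F (s e) (t e)).
Proof.
  intros HF s t Hs Ht. apply (dt_let (fun e y => F (s e) y)); [|assumption].
  apply (dt_let (fun e x => F x (e 0)) _); [|apply dt_weaken; assumption].
  exact HF.
Qed.

Lemma dt_app3 (F : M -> M -> M -> M) : definable_fun3 F -> forall s t u, definable_term s -> definable_term t -> definable_term u ->
  definable_term (fun e => F (s e) (t e) (u e)).
Proof.
  intros HF s t u Hs Ht Hu. apply (dt_let (fun e z => F (s e) (t e) z)); [|assumption].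
  apply (dt_let (fun e y => F (s (fun i => e (S i))) y (e 0)) _); [|apply dt_weaken; assumption].
  apply (dt_let (fun e x => F x (e 0) (e 1)) _).
  - exact HF.
  - apply (dt_rename s (fun i => S (S i))). assumption.
Qed.

Lemma dfn_app1 (P : M -> Prop) : definable1 P -> forall s, definable_term s -> definable (fun e => P (s e)).
Proof. intros HP s. apply dfn_let1. exact HP. Qed.

Lemma dfn_app2 (P : M -> M -> Prop) : definable2 P -> forall s t, definable_term s -> definable_term t -> definable (fun e => P (s e) (t e)).
Proof. intros HP s t. apply dfn_let2. exact HP. Qed.

Lemma model_inhabited : inhabited M.
Proof. destruct (zfu_infinity M ZF) as (s & _). exact (inhabits s). Qed.

(** Definite description. When nothing or more than one object satisfies [Q], the
    epsilon operator is applied to the empty predicate, so the value is one fixed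
    element and the graph stays definable ([dt_the]). *)
Definition the (Q : M -> Prop) : M := epsilon model_inhabited (unique Q).

Lemma the_spec (Q : M -> Prop) : (exists! y, Q y) -> Q (the Q).
Proof. intros H. apply (epsilon_spec model_inhabited (unique Q) H). Qed.

Lemma the_eq (Q : M -> Prop) (y : M) : Q y -> (forall z, Q z -> z = y) -> the Q = y.
Proof.
  intros Hy H. apply H, the_spec. exists y. split; [exact Hy|]. intros z Hz. symmetry; auto.
Qed.

Lemma dt_the (Q : env -> M -> Prop) :
  definable (fun e => Q (fun i => e (S i)) (e 0)) -> definable_term (fun e => the (Q e)).
Proof.
  intros H. unfold definable_term.
  apply (dfn_ext (fun e => unique (Q (fun i => e (S i))) (e 0) \/
    ((~ exists y, unique (Q (fun i => e (S i))) y) /\ e 0 = epsilon model_inhabited (fun _ => False)))).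
  - intros e. unfold the. set (Q' := Q (fun i => e (S i))). split.
    + intros [U|[N E]].
      * destruct (epsilon_spec model_inhabited (unique Q') (ex_intro _ _ U)) as [H1 _].
        symmetry. apply U in H1. symmetry. exact H1.
      * rewrite E. f_equal. extensionality y. apply propositional_extensionality.
        split; [tauto|]. intros U. apply N. exists y. exact U.
    + intros E. destruct (classic (exists y, unique Q' y)) as [U|N].
      * left. rewrite E. apply epsilon_spec. exact U.
      * right. split; [exact N|]. rewrite E. f_equal. extensionality y.
        apply propositional_extensionality. split; [|tauto]. intros U. apply N. exists y. exact U.
  - unfold unique. apply dfn_or.
    + apply dfn_and; [exact H|]. apply dfn_all, dfn_imp; [|apply dfn_eq; apply dt_var].
      exact (dfn_rename _ (fun i => match i with O => O | S j => S (S j) end) H).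
    + apply dfn_and; [|apply dfn_eq; [apply dt_var|apply dt_const]].
      apply dfn_not, dfn_ex, dfn_and.
      * exact (dfn_rename _ (fun i => match i with O => O | S j => S (S j) end) H).
      * apply dfn_all, dfn_imp; [|apply dfn_eq; apply dt_var].
        exact (dfn_rename _ (fun i => match i with O => O | S j => S (S (S j)) end) H).
Qed.

(** Urelements behave like the empty set here, so that separation and replacement
    can be applied to arbitrary objects. *)
Lemma dfn_separation (P : M -> Prop) (x : M) : definable1 P ->
  exists y : M, is_set y /\ forall z, z ∈ y <-> z ∈ x /\ P z.
Proof.
  intros (p & s & Hp).
  destruct (classic (ur x)) as [Hx|Hx].
  { destruct (zfu_infinity M ZF) as (_ & _ & (o & (Ho & Ho') & _) & _).
    exists o. split; [exact Ho|]. intros z. split.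
    - intros H. destruct (Ho' z H).
    - intros [H _]. destruct (zfu_urelements M ZF x z Hx H). }
  destruct (zfu_separation M ZF
    (rename (fun i => match s i with inl O => O | _ => S i end) p)
    (fun i => match s i with inl _ => x | inr a => a end) x Hx) as (y & Hy & H).
  exists y. split; [exact Hy|]. intros z. rewrite H, sat_rename, <- (Hp (z .: fun _ => x)).
  assert (E : sat (fun i => (z .: (fun i => match s i with inl _ => x | inr a => a end))
    match s i with inl O => O | _ => S i end) p <-> sat (slot s (z .: fun _ => x)) p).
  { apply sat_ext. intros i _. unfold slot. destruct (s i) as [[|j]|a] eqn:Hs; simpl; try rewrite Hs; reflexivity. }
  rewrite E. tauto.
Qed.

Lemma dfn_replacement (F : M -> M) (x : M) : definable_fun1 F ->
  exists y : M, is_set y /\ forall v, v ∈ y <-> exists u, u ∈ x /\ v = F u.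
Proof.
  intros (p & s & Hp).
  destruct (classic (ur x)) as [Hx|Hx].
  { destruct (zfu_infinity M ZF) as (_ & _ & (o & (Ho & Ho') & _) & _).
    exists o. split; [exact Ho|]. intros z. split.
    - intros H. destruct (Ho' z H).
    - intros (u & H & _). destruct (zfu_urelements M ZF x u Hx H). }
  set (q := rename (fun i => match s i with inl O => 1 | inl (S O) => 0 | _ => S (S i) end) p).
  set (e := fun i => match s i with inl _ => x | inr a => a end).
  assert (E : forall u v, sat (u .: v .: e) q <-> v = F u).
  { intros u v. unfold q. rewrite sat_rename, <- (Hp (v .: u .: fun _ => x)).
    apply sat_ext. intros i _. unfold slot, e.
    destruct (s i) as [[|[|j]]|a] eqn:Hs; simpl; try rewrite Hs; reflexivity. }
  destruct (zfu_replacement M ZF q e x Hx) as (y & Hy & H).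
  { intros u _. exists (F u). split; [apply E; reflexivity|]. intros v Hv. symmetry. apply E, Hv. }
  exists y. split; [exact Hy|]. intros v. rewrite H.
  split; intros (u & Hu & Hv); exists u; (split; [exact Hu|]); apply E, Hv.
Qed.

(** * Basic set operations *)

Definition setof (Q : M -> Prop) : M := the (fun y => is_set y /\ forall z, z ∈ y <-> Q z).

Definition small (Q : M -> Prop) : Prop := exists y, is_set y /\ forall z, z ∈ y <-> Q z.

Lemma set_ext (x y : M) : is_set x -> is_set y -> (forall z, z ∈ x <-> z ∈ y) -> x = y.
Proof. apply (zfu_extensionality M ZF). Qed.

Lemma setof_spec (Q : M -> Prop) : small Q -> is_set (setof Q) /\ forall z, z ∈ setof Q <-> Q z.
Proof.
  intros (y & Hy & H). apply (the_spec (fun y => is_set y /\ forall z, z ∈ y <-> Q z)).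
  exists y. split; [auto|]. intros y' [Hy' H']. apply set_ext; auto.
  intros z. rewrite H, H'. tauto.
Qed.

Lemma no_mem_ur (a x : M) : ur a -> x ∈ a -> False.
Proof. intros H H'. exact (zfu_urelements M ZF a x H H'). Qed.

Lemma has_mem_set (x z : M) : z ∈ x -> is_set x.
Proof. intros H U. exact (no_mem_ur x z U H). Qed.

Lemma subset_antisym (x y : M) : is_set x -> is_set y -> x ⊆ y -> y ⊆ x -> x = y.
Proof. intros Hx Hy H H'. apply set_ext; auto. intros z; split; auto. Qed.

Lemma setof_ext (P Q : M -> Prop) : (forall z, P z <-> Q z) -> setof P = setof Q.
Proof.
  intros H. f_equal. extensionality z. apply propositional_extensionality, H.
Qed.

Definition empty : M := setof (fun _ => False).
Definition upair (x y : M) : M := setof (fun z => z = x \/ z = y).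
Definition opair (x y : M) : M := upair (upair x x) (upair x y).
Definition union (x : M) : M := setof (fun z => exists y, y ∈ x /\ z ∈ y).
Definition cup (x y : M) : M := setof (fun z => z ∈ x \/ z ∈ y).
Definition succ (x : M) : M := setof (fun z => z ∈ x \/ z = x).
Definition pow (x : M) : M := setof (fun z => is_set z /\ z ⊆ x).
Definition sep (x : M) (P : M -> Prop) : M := setof (fun z => z ∈ x /\ P z).
Definition img (x : M) (F : M -> M) : M := setof (fun z => exists u, u ∈ x /\ z = F u).
Definition prod (x y : M) : M :=
  setof (fun z => exists u v, u ∈ x /\ v ∈ y /\ z = opair u v).
Definition ap (f u : M) : M := the (fun v => opair u v ∈ f).
Definition graph (x : M) (F : M -> M) : M := img x (fun u => opair u (F u)).

(** Definability goals are solved by following the syntax of the predicate;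
    set operations are unfolded down to [the]. Operations obtained by recursion are
    supported by redefining [dfn_extra]. *)
Ltac dfn_extra := fail.

Ltac dfn_step :=
  cbv beta;
  first
  [ assumption
  | match goal with
    | H : definable1 ?P |- _ => simple apply (dfn_app1 P H)
    | H : definable2 ?P |- _ => simple apply (dfn_app2 P H)
    | H : definable_fun1 ?F |- _ => simple apply (dt_app1 F H)
    | H : definable_fun2 ?F |- _ => simple apply (dt_app2 F H)
    | H : definable_fun3 ?F |- _ => simple apply (dt_app3 F H)
    end
  | dfn_extra
  | simple apply dfn_False
  | simple apply dfn_const
  | simple apply dfn_eq
  | simple apply dfn_mem
  | simple apply dfn_ur
  | simple apply dfn_and
  | simple apply dfn_or
  | simple apply dfn_not
  | simple apply dfn_iff
  | simple apply dfn_imp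
  | simple apply dfn_all
  | simple apply dfn_ex
  | simple apply dt_var
  | simple apply dt_const
  | simple apply dt_the
  | progress unfold definable1, definable2, definable_fun1, definable_fun2, definable_fun3
  | progress unfold graph, ap, prod, img, sep, pow, succ, cup, union, opair, upair, empty, setof, is_set, subset ].

Ltac dfn := repeat dfn_step.

Lemma empty_spec : is_set empty /\ forall z, ~ z ∈ empty.
Proof.
  destruct (setof_spec (fun _ => False)) as [H1 H2].
  - destruct (zfu_infinity M ZF) as (_ & _ & (o & (Ho & Ho') & _) & _).
    exists o. split; [exact Ho|]. intros z. split; [apply Ho'|tauto].
  - split; [exact H1|]. intros z Hz. exact (proj1 (H2 z) Hz).
Qed.

Lemma upair_spec (x y : M) : is_set (upair x y) /\ forall z, z ∈ upair x y <-> z = x \/ z = y.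
Proof. apply setof_spec. exact (zfu_pairing M ZF x y). Qed.

Lemma union_spec (x : M) : is_set (union x) /\ forall z, z ∈ union x <-> exists y, y ∈ x /\ z ∈ y.
Proof.
  apply setof_spec. destruct (classic (ur x)) as [Hx|Hx].
  - exists empty. destruct empty_spec as [H1 H2]. split; [exact H1|]. intros z. split.
    + intros H. destruct (H2 z H).
    + intros (y & H & _). destruct (no_mem_ur x y Hx H).
  - exact (zfu_union M ZF x Hx).
Qed.

Lemma cup_spec (x y : M) : is_set (cup x y) /\ forall z, z ∈ cup x y <-> z ∈ x \/ z ∈ y.
Proof.
  apply setof_spec. exists (union (upair x y)). split; [apply union_spec|].
  intros z. rewrite (proj2 (union_spec _)). split.
  - intros (w & Hw & Hz). apply upair_spec in Hw. destruct Hw; subst; auto.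
  - intros [H|H]; [exists x|exists y]; (split; [apply upair_spec; auto|exact H]).
Qed.

Lemma succ_spec (x : M) : is_set (succ x) /\ forall z, z ∈ succ x <-> z ∈ x \/ z = x.
Proof.
  apply setof_spec. exists (cup x (upair x x)). split; [apply cup_spec|].
  intros z. rewrite (proj2 (cup_spec _ _)), (proj2 (upair_spec _ _)). tauto.
Qed.

Lemma pow_spec (x : M) : is_set (pow x) /\ forall z, z ∈ pow x <-> is_set z /\ z ⊆ x.
Proof.
  apply setof_spec. destruct (classic (ur x)) as [Hx|Hx].
  - destruct (zfu_powerset M ZF empty (proj1 empty_spec)) as (p & Hp & H).
    exists p. split; [exact Hp|]. intros z. rewrite H.
    split; intros [H1 H2]; (split; [exact H1|]); intros w Hw; apply H2 in Hw.
    + destruct (proj2 empty_spec w Hw).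
    + destruct (no_mem_ur x w Hx Hw).
  - exact (zfu_powerset M ZF x Hx).
Qed.

Lemma sep_spec (x : M) (P : M -> Prop) : definable1 P ->
  is_set (sep x P) /\ forall z, z ∈ sep x P <-> z ∈ x /\ P z.
Proof. intros H. apply setof_spec. exact (dfn_separation P x H). Qed.

Lemma img_spec (x : M) (F : M -> M) : definable_fun1 F ->
  is_set (img x F) /\ forall z, z ∈ img x F <-> exists u, u ∈ x /\ z = F u.
Proof. intros H. apply setof_spec. exact (dfn_replacement F x H). Qed.

Lemma prod_spec (x y : M) : is_set (prod x y) /\
  forall z, z ∈ prod x y <-> exists u v, u ∈ x /\ v ∈ y /\ z = opair u v.
Proof.
  apply setof_spec.
  assert (D1 : forall u, definable_fun1 (fun v => opair u v)) by (intros u; dfn).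
  assert (D2 : definable_fun1 (fun u => img y (fun v => opair u v))) by dfn.
  exists (union (img x (fun u => img y (fun v => opair u v)))).
  split; [apply union_spec|]. intros z. rewrite (proj2 (union_spec _)). split.
  - intros (w & Hw & Hz). apply img_spec in Hw; [|exact D2]. destruct Hw as (u & Hu & ->).
    apply img_spec in Hz; [|apply D1]. destruct Hz as (v & Hv & ->). exists u, v. auto.
  - intros (u & v & Hu & Hv & ->). exists (img y (fun v => opair u v)). split.
    + apply img_spec; [exact D2|]. exists u. auto.
    + apply img_spec; [apply D1|]. exists v. auto.
Qed.

Lemma upair_inj (x y z w : M) : upair x y = upair z w -> (x = z /\ y = w) \/ (x = w /\ y = z).
Proof.
  intros E. assert (H : forall t, t = x \/ t = y <-> t = z \/ t = w).
  { intros t. rewrite <- !(proj2 (upair_spec _ _)), E. tauto. }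
  pose proof (proj1 (H x) (or_introl eq_refl)). pose proof (proj1 (H y) (or_intror eq_refl)).
  pose proof (proj2 (H z) (or_introl eq_refl)). pose proof (proj2 (H w) (or_intror eq_refl)).
  intuition congruence.
Qed.

Lemma opair_inj (x y z w : M) : opair x y = opair z w -> x = z /\ y = w.
Proof.
  intros E. apply upair_inj in E. destruct E as [[E1 E2]|[E1 E2]];
    apply upair_inj in E1; apply upair_inj in E2; intuition congruence.
Qed.

Lemma is_pair_upair (p x y : M) : is_pair p x y <-> p = upair x y.
Proof.
  split.
  - intros [H1 H2]. apply set_ext; [exact H1|apply upair_spec|].
    intros z. rewrite H2, (proj2 (upair_spec _ _)). tauto.
  - intros ->. apply upair_spec.
Qed.

Lemma is_opair_opair (p x y : M) : is_opair p x y <-> p = opair x y.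
Proof.
  unfold is_opair. split.
  - intros (a & b & Ha & Hb & Hp). apply is_pair_upair in Ha, Hb, Hp. subst. reflexivity.
  - intros ->. exists (upair x x), (upair x y). rewrite !is_pair_upair. auto.
Qed.

Lemma app_opair (f u v : M) : app f u v <-> opair u v ∈ f.
Proof.
  unfold app. split.
  - intros (p & Hp & H). apply is_opair_opair in H. subst. exact Hp.
  - intros H. exists (opair u v). split; [exact H|]. apply is_opair_opair. reflexivity.
Qed.

Lemma is_product_prod (p x y : M) : is_product p x y -> p = prod x y.
Proof.
  intros [H1 H2]. apply set_ext; [exact H1|apply prod_spec|].
  intros z. rewrite H2, (proj2 (prod_spec _ _)).
  split; intros (u & v & Hu & Hv & H); exists u, v; apply is_opair_opair in H; auto.
Qed.

Lemma opair_prod (x y u v : M) : opair u v ∈ prod x y <-> u ∈ x /\ v ∈ y.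
Proof.
  rewrite (proj2 (prod_spec _ _)). split.
  - intros (u' & v' & Hu & Hv & E). apply opair_inj in E. destruct E; subst; auto.
  - intros [Hu Hv]. exists u, v. auto.
Qed.

Lemma ap_graph (x u : M) (F : M -> M) : definable_fun1 F -> u ∈ x -> ap (graph x F) u = F u.
Proof.
  intros HF Hu.
  assert (D : definable_fun1 (fun u => opair u (F u))) by dfn.
  apply the_eq.
  - apply img_spec; [exact D|]. exists u. auto.
  - intros z Hz. apply img_spec in Hz; [|exact D]. destruct Hz as (w & _ & E).
    apply opair_inj in E. destruct E; subst; reflexivity.
Qed.

(** Relativizing to a set [x] takes the place of passing to a transitive closure, which
    is only available after recursion. *)
Lemma foundation_set (x : M) (P : M -> Prop) : definable1 P -> (exists y, y ∈ x /\ P y) ->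
  exists y, y ∈ x /\ P y /\ forall z, z ∈ y -> z ∈ x -> ~ P z.
Proof.
  intros HP (y & Hy & Py).
  destruct (zfu_foundation M ZF (sep x P)) as (m & Hm & H).
  - exists y. apply sep_spec; auto.
  - apply sep_spec in Hm; [|exact HP]. exists m. split; [apply Hm|]. split; [apply Hm|].
    intros z Hz Hzx Pz. apply (H z); [|exact Hz]. apply sep_spec; auto.
Qed.

(** * Recursion on membership *)

(** The recursion equation is [rec p x = G p x {rec p u | u ∈ x}], with a parameter
    [p]. It is proved for elements of transitive sets first: this suffices for
    recursion on ω, which yields a transitive superset of every object, and with it
    the general case. *)

Section Recursion.

Context (G : M -> M -> M -> M) (HG : definable_fun3 G).

Definition values (f u : M) : M := setof (fun z => exists w, w ∈ u /\ opair w z ∈ f).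

(** A partial solution whose domain is closed under membership. The
    equation forces the second components of pairs with the same first one to agree. *)
Definition attempt (p f : M) : Prop :=
  forall u v, opair u v ∈ f ->
    (forall w, w ∈ u -> exists z, opair w z ∈ f) /\ v = G p u (values f u).

Definition rec (p x : M) : M := the (fun v => exists f, attempt p f /\ opair x v ∈ f).

Lemma dt2_rec : definable_fun2 rec.
Proof. unfold rec, attempt, values. dfn. Qed.

Lemma field_of_pairs (f u v : M) : opair u v ∈ f -> u ∈ union (union f).
Proof.
  intros H. apply union_spec. exists (upair u v). split.
  - apply union_spec. exists (opair u v). split; [exact H|]. apply upair_spec. auto.
  - apply upair_spec. auto.
Qed.

Lemma attempt_agree (p f f' u v v' : M) : attempt p f -> attempt p f' ->
  opair u v ∈ f -> opair u v' ∈ f' -> v = v'.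
Proof.
  intros Hf Hf' Hu Hu'.
  destruct (classic (v = v')) as [|N]; [assumption|].
  destruct (foundation_set (union (union f))
    (fun u => exists v v', opair u v ∈ f /\ opair u v' ∈ f' /\ v <> v')) as (m & _ & Hm & Hmin).
  - dfn.
  - exists u. split; [eapply field_of_pairs; eassumption|]. exists v, v'. auto.
  - destruct Hm as (w & w' & Hw & Hw' & Nw). destruct Nw.
    destruct (Hf _ _ Hw) as [H1 ->]. destruct (Hf' _ _ Hw') as [H2 ->].
    f_equal. apply setof_ext.
    assert (A : forall y z z', y ∈ m -> opair y z ∈ f -> opair y z' ∈ f' -> z = z').
    { intros y z z' Hy Hz Hz'. destruct (classic (z = z')) as [|Nz]; [assumption|].
      destruct (Hmin y Hy); [eapply field_of_pairs; eassumption|]. exists z, z'. auto. }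
    intros z. split; intros (y & Hy & Hz); exists y; (split; [exact Hy|]).
    + destruct (H2 y Hy) as (z' & Hz'). rewrite (A y z z'); assumption.
    + destruct (H1 y Hy) as (z' & Hz'). rewrite <- (A y z' z); assumption.
Qed.

Definition defined (p x : M) : Prop := exists f v, attempt p f /\ opair x v ∈ f.

Lemma rec_attempt (p f x v : M) : attempt p f -> opair x v ∈ f -> rec p x = v.
Proof.
  intros Hf Hx. apply the_eq.
  - exists f. auto.
  - intros z (f' & Hf' & Hz). exact (attempt_agree p f' f x z v Hf' Hf Hz Hx).
Qed.

Lemma values_rec (p f x v : M) : attempt p f -> opair x v ∈ f -> values f x = img x (rec p).
Proof.
  intros Hf Hx. apply setof_ext. intros z. split.
  - intros (w & Hw & Hz). exists w. split; [exact Hw|]. symmetry. eapply rec_attempt; eassumption.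
  - intros (w & Hw & ->). destruct (Hf _ _ Hx) as [H _]. destruct (H w Hw) as (z & Hz).
    exists w. split; [exact Hw|]. rewrite (rec_attempt p f w z Hf Hz). exact Hz.
Qed.

Lemma rec_defined (p x : M) : defined p x -> rec p x = G p x (img x (rec p)).
Proof.
  intros (f & v & Hf & Hx). rewrite (rec_attempt p f x v Hf Hx).
  rewrite <- (values_rec p f x v Hf Hx). apply (Hf x v Hx).
Qed.

(** The values of [rec] on [t], together with one new pair for [x], form an attempt.
    Choosing attempts for the elements of [x] separately would call for Collection;
    Replacement applied to [rec] itself does not. *)
Lemma defined_step (p t x : M) : (forall y, y ∈ t -> defined p y) ->
  (forall y z, y ∈ t -> z ∈ y -> z ∈ t) -> x ⊆ t -> ~ x ∈ t -> defined p x.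
Proof.
  intros Hd Ht Hx Nx.
  pose proof dt2_rec as DR.
  assert (DP : definable_fun1 (fun w => opair w (rec p w))) by dfn.
  set (f := cup (graph t (rec p)) (upair (opair x (G p x (img x (rec p)))) (opair x (G p x (img x (rec p)))))).
  assert (Hf : forall u v, opair u v ∈ f <-> (u ∈ t /\ v = rec p u) \/ (u = x /\ v = G p x (img x (rec p)))).
  { intros u v. unfold f. rewrite (proj2 (cup_spec _ _)), (proj2 (upair_spec _ _)).
    unfold graph. rewrite (proj2 (img_spec t _ DP)). split.
    - intros [(w & Hw & E)|[E|E]]; apply opair_inj in E; destruct E; subst; auto.
    - intros [[Hu ->]|[-> ->]]; [left; exists u; auto|auto]. }
  exists f, (G p x (img x (rec p))). split; [|apply Hf; auto].
  assert (HV : forall u, u ⊆ t -> values f u = img u (rec p)).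
  { intros u Hu. apply setof_ext. intros z. split.
    - intros (w & Hw & Hz). apply Hf in Hz. destruct Hz as [[_ ->]|[-> _]]; [exists w; auto|].
      destruct Nx. auto.
    - intros (w & Hw & ->). exists w. split; [exact Hw|]. apply Hf. auto. }
  intros u v H. apply Hf in H.
  assert (Hu : u ⊆ t) by (destruct H as [[H _]|[-> _]]; [intros z; apply Ht, H|exact Hx]).
  split.
  - intros w Hw. exists (rec p w). apply Hf. auto.
  - rewrite (HV u Hu). destruct H as [[H ->]|[-> ->]]; [|reflexivity]. apply rec_defined, Hd, H.
Qed.

(** At a minimal failure [m], the elements of [t] at which [rec] is defined form a
    transitive set that includes [m]. *)
Lemma defined_in_transitive (p t x : M) : transitive t -> x ∈ t -> defined p x.
Proof.
  intros Ht Hx. destruct (classic (defined p x)) as [|N]; [assumption|].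
  assert (Dd : definable1 (defined p)) by (unfold defined, attempt, values; dfn).
  destruct (foundation_set t (fun x => ~ defined p x)) as (m & Hm & Nm & Hmin).
  - dfn.
  - exists x. auto.
  - exfalso. apply Nm. apply (defined_step p (sep t (defined p))).
    + intros y Hy. apply sep_spec in Hy; [apply Hy|exact Dd].
    + intros y z Hy Hz. apply sep_spec in Hy; [|exact Dd]. apply sep_spec; [exact Dd|].
      destruct Hy as [Hy (f & v & Hf & Hv)]. split; [exact (Ht y z Hy Hz)|].
      destruct (proj1 (Hf y v Hv) z Hz) as (v' & Hv'). exists f, v'. auto.
    + intros y Hy. apply sep_spec; [exact Dd|]. split; [exact (Ht m y Hm Hy)|].
      destruct (classic (defined p y)) as [|Ny]; [assumption|].
      destruct (Hmin y Hy (Ht m y Hm Hy) Ny).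
    + intros H. apply sep_spec in H; [|exact Dd]. apply Nm, H.
Qed.

End Recursion.

Definition omega_mem (n : M) : Prop :=
  forall s, empty ∈ s -> (forall x, x ∈ s -> succ x ∈ s) -> n ∈ s.

(** ω is the intersection of the inductive sets; since the elements of ω that are
    subsets of ω form an inductive set again, ω is transitive. *)
Lemma omega_exists : exists w, is_set w /\ transitive w /\ empty ∈ w /\
  (forall n, n ∈ w -> succ n ∈ w).
Proof.
  assert (D : definable1 omega_mem) by (unfold omega_mem; dfn).
  destruct (zfu_infinity M ZF) as (s & _ & (o & [Ho Ho'] & Hos) & Hs).
  assert (E : o = empty).
  { apply set_ext; [exact Ho|apply empty_spec|]. intros z. split; intros H.
    - destruct (Ho' z H).
    - destruct (proj2 empty_spec z H). }
  subst o.
  assert (Hs' : forall x, x ∈ s -> succ x ∈ s).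
  { intros x Hx. destruct (Hs x Hx) as (y & Hy & Sy & H).
    replace (succ x) with y; [exact Hy|]. apply set_ext; [exact Sy|apply succ_spec|].
    intros z. rewrite H, (proj2 (succ_spec x)). tauto. }
  set (w := sep s omega_mem).
  assert (Hw : forall n, n ∈ w <-> omega_mem n).
  { intros n. unfold w. rewrite (proj2 (sep_spec s _ D)). split; [tauto|].
    intros H. split; [apply H; assumption|exact H]. }
  assert (W0 : empty ∈ w) by (apply Hw; intros r H0 _; exact H0).
  assert (WS : forall n, n ∈ w -> succ n ∈ w).
  { intros n Hn. apply Hw. apply Hw in Hn. intros r H0 H1. apply H1, Hn; assumption. }
  assert (Ind : forall P : M -> Prop, definable1 P -> P empty ->
    (forall n, n ∈ w -> P n -> P (succ n)) -> forall n, n ∈ w -> P n).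
  { intros P DP P0 PS n Hn. apply Hw in Hn. apply (sep_spec w P DP). apply Hn.
    - apply sep_spec; auto.
    - intros x Hx. apply sep_spec in Hx; [|exact DP]. destruct Hx.
      apply sep_spec; [exact DP|]. auto. }
  exists w. split; [apply sep_spec, D|]. split; [|auto].
  assert (T : forall n, n ∈ w -> n ⊆ w).
  { apply Ind.
    - dfn.
    - intros z Hz. destruct (proj2 empty_spec z Hz).
    - intros n Hn IH z Hz. apply succ_spec in Hz. destruct Hz as [Hz| ->]; auto. }
  intros y z Hy Hz. exact (T y Hy z Hz).
Qed.

(** The [n]-th iterate of the union operation, started at [{x}], is accumulated by
    recursion on [n ∈ ω]. *)
Lemma transitive_superset (x : M) : exists t, is_set t /\ transitive t /\ x ∈ t.
Proof.
  destruct omega_exists as (w & _ & Tw & W0 & WS).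
  set (x0 := upair x x).
  set (G := fun _ _ i : M => cup x0 (union (union i))).
  assert (DG : definable_fun3 G) by (unfold G; dfn).
  set (F := rec G empty).
  assert (DF : definable_fun1 F).
  { pose proof (dt2_rec G DG). unfold F. dfn. }
  assert (HF : forall n, n ∈ w -> F n = cup x0 (union (union (img n F)))).
  { intros n Hn. apply rec_defined. apply (defined_in_transitive G DG empty w n Tw Hn). }
  exists (union (img w F)). split; [apply union_spec|]. split.
  - intros y z Hy Hz. apply union_spec in Hy. destruct Hy as (v & Hv & Hy).
    apply img_spec in Hv; [|exact DF]. destruct Hv as (n & Hn & ->).
    apply union_spec. exists (F (succ n)). split.
    + apply img_spec; [exact DF|]. exists (succ n). auto.
    + rewrite HF by auto. apply cup_spec. right. apply union_spec. exists y. split; [|exact Hz].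
      apply union_spec. exists (F n). split; [|exact Hy].
      apply img_spec; [exact DF|]. exists n. split; [apply succ_spec; auto|reflexivity].
  - apply union_spec. exists (F empty). split.
    + apply img_spec; [exact DF|]. exists empty. auto.
    + rewrite HF by assumption. apply cup_spec. left. apply upair_spec. auto.
Qed.

Lemma mem_induction (P : M -> Prop) : definable1 P ->
  (forall x, (forall y, y ∈ x -> P y) -> P x) -> forall x, P x.
Proof.
  intros DP H x. destruct (classic (P x)) as [|N]; [assumption|].
  destruct (transitive_superset x) as (t & _ & Tt & Hx).
  destruct (foundation_set t (fun x => ~ P x)) as (m & Hm & Nm & Hmin).
  - dfn.
  - exists x. auto.
  - exfalso. apply Nm, H. intros y Hy. apply NNPP, Hmin; [exact Hy|exact (Tt m y Hm Hy)].
Qed.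

Lemma rec_eq (G : M -> M -> M -> M) (DG : definable_fun3 G) (p x : M) :
  rec G p x = G p x (img x (rec G p)).
Proof.
  apply rec_defined. destruct (transitive_superset x) as (t & _ & Tt & Hx).
  exact (defined_in_transitive G DG p t x Tt Hx).
Qed.

Lemma mem_irrefl (x : M) : ~ x ∈ x.
Proof.
  revert x. apply mem_induction; [dfn|]. intros x IH H. exact (IH x H H).
Qed.

(** * Ordinals *)

(** With Foundation, being a transitive set of transitive sets already implies the
    well-ordering, and it passes to elements and unions at once. *)
Definition ord (a : M) : Prop :=
  is_set a /\ transitive a /\ forall y, y ∈ a -> is_set y /\ transitive y.

Lemma dfn_ord : definable1 ord.
Proof. unfold ord, transitive. dfn. Qed.

Lemma is_ordinal_ord (a : M) : is_ordinal a -> ord a.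
Proof.
  intros (Sa & Ta & Ha & _ & W & _). split; [exact Sa|]. split; [exact Ta|].
  intros y Hy. split.
  - apply Ha. intros t _ _ H. exact (H y Hy).
  - intros z u Hz Hu. pose proof (Ta y z Hy Hz). pose proof (Ta z u H Hu).
    apply (W u z y); assumption.
Qed.

Lemma ord_mem (a b : M) : ord a -> b ∈ a -> ord b.
Proof.
  intros (Sa & Ta & Ha) Hb. destruct (Ha b Hb). split; [assumption|]. split; [assumption|].
  intros y Hy. apply Ha, (Ta b y Hb Hy).
Qed.

Lemma ord_mem_subset (a b : M) : ord a -> b ∈ a -> b ⊆ a.
Proof. intros (_ & Ta & _) Hb z Hz. exact (Ta b z Hb Hz). Qed.

Ltac dfn_extra ::= simple apply (dfn_app1 ord dfn_ord).

Lemma ord_trichotomy (a b : M) : ord a -> ord b -> a ∈ b \/ a = b \/ b ∈ a.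
Proof.
  revert a b.
  enough (E : forall a, ord a -> forall b, ord b -> a ∈ b \/ a = b \/ b ∈ a) by eauto.
  apply (mem_induction (fun a => ord a -> forall b, ord b -> a ∈ b \/ a = b \/ b ∈ a)); [dfn|].
  intros a IHa Oa. apply (mem_induction (fun b => ord b -> a ∈ b \/ a = b \/ b ∈ a)); [dfn|].
  intros b IHb Ob. destruct (classic (a ∈ b)) as [|N]; [auto|].
  destruct (classic (b ∈ a)) as [|N']; [auto|]. right. left.
  apply subset_antisym; [exact (proj1 Oa)|exact (proj1 Ob)| |].
  - intros u Hu. destruct (IHa u Hu (ord_mem a u Oa Hu) b Ob) as [H|[->|H]]; [exact H|tauto|].
    exfalso; apply N'. exact (ord_mem_subset a u Oa Hu b H).
  - intros u Hu. destruct (IHb u Hu (ord_mem b u Ob Hu)) as [H|[->|H]]; [|tauto|exact H].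
    exfalso; apply N. exact (ord_mem_subset b u Ob Hu a H).
Qed.

Lemma ord_total (a b : M) : ord a -> ord b -> a ⊆ b \/ b ∈ a.
Proof.
  intros Oa Ob. destruct (ord_trichotomy a b Oa Ob) as [H|[->|H]]; auto.
  - left. exact (ord_mem_subset b a Ob H).
  - left. intros z Hz. exact Hz.
Qed.

Lemma ord_empty : ord empty.
Proof.
  pose proof (proj2 empty_spec) as E. split; [apply empty_spec|]. split.
  - intros y z Hy. destruct (E y Hy).
  - intros y Hy. destruct (E y Hy).
Qed.

Lemma ord_succ (a : M) : ord a -> ord (succ a).
Proof.
  intros Oa. split; [apply succ_spec|]. split.
  - intros y z Hy Hz. apply succ_spec in Hy. apply succ_spec. left.
    destruct Hy as [Hy| ->]; [|exact Hz]. exact (ord_mem_subset a y Oa Hy z Hz).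
  - intros y Hy. apply succ_spec in Hy. destruct Hy as [Hy| ->]; [apply Oa, Hy|].
    split; [exact (proj1 Oa)|exact (proj1 (proj2 Oa))].
Qed.

Lemma ord_union (x : M) : (forall a, a ∈ x -> ord a) -> ord (union x).
Proof.
  intros H. split; [apply union_spec|]. split.
  - intros y z Hy Hz. apply union_spec in Hy. destruct Hy as (a & Ha & Hy).
    apply union_spec. exists a. split; [exact Ha|]. exact (ord_mem_subset a y (H a Ha) Hy z Hz).
  - intros y Hy. apply union_spec in Hy. destruct Hy as (a & Ha & Hy). apply (H a Ha), Hy.
Qed.

Lemma union_upper (x a : M) : a ∈ x -> a ⊆ union x.
Proof. intros H z Hz. apply union_spec. exists a. auto. Qed.

(** Picking least ordinals replaces choice throughout: it turns a definable relation
    into a definable function, to which Replacement applies. *)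
Definition least (Q : M -> Prop) : M :=
  the (fun a => ord a /\ Q a /\ forall b, ord b -> Q b -> a ⊆ b).

Lemma least_spec (Q : M -> Prop) : definable1 Q -> (exists a, ord a /\ Q a) ->
  ord (least Q) /\ Q (least Q) /\ forall b, ord b -> Q b -> least Q ⊆ b.
Proof.
  intros DQ (a & Oa & Qa). apply (the_spec (fun a => ord a /\ Q a /\ forall b, ord b -> Q b -> a ⊆ b)).
  destruct (foundation_set (succ a) (fun b => ord b /\ Q b)) as (m & Hm & [Om Qm] & Hmin).
  - dfn.
  - exists a. split; [apply succ_spec; auto|auto].
  - assert (L : forall b, ord b -> Q b -> m ⊆ b).
    { intros b Ob Qb. destruct (ord_total m b Om Ob) as [H|H]; [exact H|].
      destruct (Hmin b H); [|auto]. exact (ord_mem_subset _ m (ord_succ a Oa) Hm b H). }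
    exists m. split; [auto|]. intros m' (Om' & Qm' & L').
    apply subset_antisym; [exact (proj1 Om)|exact (proj1 Om')| |]; auto.
Qed.

(** Collection restricted to ordinals, valid since the least ordinals form a set. *)
Lemma ord_bound (x : M) (Q : M -> M -> Prop) : definable2 Q ->
  (forall y a b, ord a -> ord b -> a ⊆ b -> Q y a -> Q y b) ->
  (forall y, y ∈ x -> exists a, ord a /\ Q y a) ->
  exists a, ord a /\ forall y, y ∈ x -> Q y a.
Proof.
  intros DQ Up H.
  set (F := fun y => least (Q y)).
  assert (DF : definable_fun1 F). { unfold F, least; dfn. }
  assert (DQ' : forall y, definable1 (Q y)) by (intros y; dfn).
  assert (HF : forall a, a ∈ img x F -> ord a).
  { intros a Ha. apply img_spec in Ha; [|exact DF]. destruct Ha as (y & Hy & ->).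
    exact (proj1 (least_spec (Q y) (DQ' y) (H y Hy))). }
  exists (union (img x F)). split; [apply ord_union, HF|].
  intros y Hy. assert (Hi : F y ∈ img x F) by (apply img_spec; [exact DF|]; eauto).
  apply (Up y (F y)); [apply HF, Hi|apply ord_union, HF|apply union_upper, Hi|].
  exact (proj1 (proj2 (least_spec (Q y) (DQ' y) (H y Hy)))).
Qed.

(** * The cumulative hierarchy over a set of urelements *)

(** [level A a] is usually written V_a(A); the characteristic equation is
    [mem_level]. *)

Definition level : M -> M -> M := rec (fun A _ i => cup A (union (img i pow))).

Lemma dt2_level : definable_fun2 level.
Proof. apply dt2_rec. dfn. Qed.

Ltac dfn_extra ::= first
  [ simple apply (dfn_app1 ord dfn_ord) | simple apply (dt_app2 level dt2_level) ].

Lemma mem_level (A a y : M) :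
  y ∈ level A a <-> y ∈ A \/ exists b, b ∈ a /\ is_set y /\ y ⊆ level A b.
Proof.
  assert (D : definable_fun1 (level A)) by dfn.
  assert (DP : definable_fun1 pow) by dfn.
  unfold level at 1. rewrite rec_eq by dfn. fold level.
  rewrite (proj2 (cup_spec _ _)), (proj2 (union_spec _)). split.
  - intros [H|(v & Hv & Hy)]; [auto|right].
    apply img_spec in Hv; [|exact DP]. destruct Hv as (u & Hu & ->).
    apply img_spec in Hu; [|exact D]. destruct Hu as (b & Hb & ->).
    exists b. split; [exact Hb|]. apply pow_spec, Hy.
  - intros [H|(b & Hb & Sy & Hy)]; [auto|right].
    exists (pow (level A b)). split; [|apply pow_spec; auto].
    apply img_spec; [exact DP|]. exists (level A b). split; [|reflexivity].
    apply img_spec; [exact D|]. eauto.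
Qed.

Lemma level_mono_ord (A a b : M) : a ⊆ b -> level A a ⊆ level A b.
Proof.
  intros H y Hy. apply mem_level. apply mem_level in Hy. destruct Hy as [|(c & Hc & Hy)]; eauto.
Qed.

Lemma level_mono_base (A B a : M) : A ⊆ B -> level A a ⊆ level B a.
Proof.
  intros H. revert a.
  apply (mem_induction (fun a => level A a ⊆ level B a)); [dfn|].
  intros a IH y Hy. apply mem_level. apply mem_level in Hy.
  destruct Hy as [Hy|(b & Hb & Sy & Hy)]; [auto|right].
  exists b. split; [exact Hb|]. split; [exact Sy|]. intros z Hz. exact (IH b Hb z (Hy z Hz)).
Qed.

Lemma level_mono (A B a b : M) : A ⊆ B -> a ⊆ b -> level A a ⊆ level B b.
Proof.
  intros H H' y Hy. apply (level_mono_base A B b H), (level_mono_ord A a b H'), Hy.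
Qed.

Definition atoms (A : M) : Prop := forall a, a ∈ A -> ur a.

Lemma level_transitive (A a : M) : atoms A -> ord a -> transitive (level A a).
Proof.
  intros HA Oa y z Hy Hz. apply mem_level in Hy. destruct Hy as [Hy|(b & Hb & _ & Hy)].
  - destruct (no_mem_ur y z (HA y Hy) Hz).
  - exact (level_mono_ord A b a (ord_mem_subset a b Oa Hb) z (Hy z Hz)).
Qed.

(** The urelements of a transitive set around [x] serve as the base [A]; each element
    of that set gets an ordinal by induction on membership. *)
Lemma level_cover (x : M) : exists A a, atoms A /\ ord a /\ x ∈ level A a.
Proof.
  destruct (transitive_superset x) as (t & _ & Tt & Hx).
  assert (DU : definable1 ur) by dfn.
  set (A := sep t ur).
  assert (E : forall y, y ∈ t -> exists a, ord a /\ y ∈ level A a).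
  { apply (mem_induction (fun y => y ∈ t -> exists a, ord a /\ y ∈ level A a)); [dfn|].
    intros y IH Hy. destruct (classic (ur y)) as [U|Sy].
    - exists empty. split; [apply ord_empty|]. apply mem_level. left. apply sep_spec; auto.
    - destruct (ord_bound y (fun z a => z ∈ level A a)) as (a & Oa & Ha).
      + dfn.
      + intros z a b _ _ H. apply level_mono_ord, H.
      + intros z Hz. apply IH; [exact Hz|exact (Tt y z Hy Hz)].
      + exists (succ a). split; [apply ord_succ, Oa|]. apply mem_level. right. exists a.
        split; [apply succ_spec; auto|auto]. }
  destruct (E x Hx) as (a & Oa & Ha). exists A, a. split; [|auto].
  intros b Hb. apply sep_spec in Hb; [apply Hb|exact DU].
Qed.

(** * Automorphisms *)

(** These are required to be definable because the lemmas about levels are proved by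
    induction inside the model. Keeping the inverse as a second argument makes the
    notion symmetric. *)

Record aut (σ τ : M -> M) : Prop := {
  aut_dt : definable_fun1 σ;
  aut_dt_inv : definable_fun1 τ;
  aut_inv_l : forall x, τ (σ x) = x;
  aut_inv_r : forall x, σ (τ x) = x;
  aut_mem : forall x y, x ∈ y -> σ x ∈ σ y;
  aut_mem_inv : forall x y, x ∈ y -> τ x ∈ τ y;
  aut_ur : forall x, ur x -> ur (σ x);
  aut_ur_inv : forall x, ur x -> ur (τ x)
}.

Lemma aut_sym (σ τ : M -> M) : aut σ τ -> aut τ σ.
Proof. intros [? ? ? ? ? ? ? ?]. constructor; assumption. Qed.

Lemma aut_comp (σ τ σ' τ' : M -> M) : aut σ τ -> aut σ' τ' ->
  aut (fun x => σ' (σ x)) (fun x => τ (τ' x)).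
Proof.
  intros [? ? L R ? ? ? ?] [? ? L' R' ? ? ? ?]. constructor; auto; try dfn.
  - intros x. rewrite L', L. reflexivity.
  - intros x. rewrite R, R'. reflexivity.
Qed.

Lemma sat_aut (σ τ : M -> M) : aut σ τ -> forall p (e : env),
  sat e p <-> sat (fun i => σ (e i)) p.
Proof.
  intros [_ _ L R Hm Hm' Hu Hu'].
  assert (Inj : forall x y, σ x = σ y -> x = y).
  { intros x y E. rewrite <- (L x), <- (L y), E. reflexivity. }
  induction p as [i j|i j|i| |p IHp q IHq|p IHp]; intros e; simpl.
  - split; [congruence|apply Inj].
  - split; [apply Hm|]. intros H. apply Hm' in H. rewrite !L in H. exact H.
  - split; [apply Hu|]. intros H. apply Hu' in H. rewrite L in H. exact H.
  - tauto.
  - rewrite (IHp e), (IHq e). tauto.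
  - assert (E : forall x, (fun i => σ ((x .: e) i)) = (σ x .: fun i => σ (e i))).
    { intros x. extensionality i. destruct i; reflexivity. }
    split; intros H x.
    + specialize (H (τ x)). apply IHp in H. rewrite E, R in H. exact H.
    + apply IHp. rewrite E. apply H.
Qed.

Lemma aut_set (σ τ : M -> M) (x : M) : aut σ τ -> is_set x -> is_set (σ x).
Proof. intros H Sx U. apply (aut_ur_inv σ τ H) in U. rewrite (aut_inv_l σ τ H) in U. exact (Sx U). Qed.

Lemma aut_mem_back (σ τ : M -> M) (x y : M) : aut σ τ -> x ∈ σ y -> τ x ∈ y.
Proof. intros H Hx. apply (aut_mem_inv σ τ H) in Hx. rewrite (aut_inv_l σ τ H) in Hx. exact Hx. Qed.

Lemma level_aut (σ τ : M -> M) (A B : M) : aut σ τ -> (forall a, a ∈ A -> σ a ∈ B) ->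
  forall a y, y ∈ level A a -> σ y ∈ level B a.
Proof.
  intros Hσ HA. pose proof (aut_dt σ τ Hσ) as Dσ.
  apply (mem_induction (fun a => forall y, y ∈ level A a -> σ y ∈ level B a)); [dfn|].
  intros a IH y Hy. apply mem_level. apply mem_level in Hy.
  destruct Hy as [Hy|(b & Hb & Sy & Hy)]; [auto|right].
  exists b. split; [exact Hb|]. split; [exact (aut_set σ τ y Hσ Sy)|].
  intros z Hz. rewrite <- (aut_inv_r σ τ Hσ z). apply (IH b Hb), Hy, (aut_mem_back σ τ); assumption.
Qed.

Lemma level_fixed (σ τ : M -> M) (A : M) : aut σ τ -> (forall a, a ∈ A -> σ a = a) ->
  forall a y, y ∈ level A a -> σ y = y.
Proof.
  intros Hσ HA. pose proof (aut_dt σ τ Hσ) as Dσ.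
  apply (mem_induction (fun a => forall y, y ∈ level A a -> σ y = y)); [dfn|].
  intros a IH y Hy. apply mem_level in Hy.
  destruct Hy as [Hy|(b & Hb & Sy & Hy)]; [auto|].
  apply set_ext; [exact (aut_set σ τ y Hσ Sy)|exact Sy|]. intros z. split; intros Hz.
  - pose proof (aut_mem_back σ τ z y Hσ Hz) as H.
    pose proof (IH b Hb _ (Hy _ H)) as E. rewrite (aut_inv_r σ τ Hσ) in E. rewrite E. exact H.
  - rewrite <- (IH b Hb z (Hy z Hz)). apply (aut_mem σ τ Hσ), Hz.
Qed.

Record embeds (k : M -> M) (W D : M) : Prop := {
  embeds_ur : forall w, w ∈ W -> ur (k w);
  embeds_off : forall w, w ∈ W -> ~ k w ∈ D;
  embeds_inj : forall w w', w ∈ W -> w' ∈ W -> k w = k w' -> w = w'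
}.

(** Two disjoint copies of [W] among the urelements are exchanged by an involution of
    the urelements, which is extended to sets by recursion on membership. *)

Section Swap.

Context (k k' : M -> M) (W D : M) (Dk : definable_fun1 k) (Dk' : definable_fun1 k')
  (Hk : embeds k W D) (Hk' : embeds k' W (cup D (img W k))).

Definition swap (a : M) : M := the (fun b =>
  (exists w, w ∈ W /\ a = k w /\ b = k' w) \/
  (exists w, w ∈ W /\ a = k' w /\ b = k w) \/
  ((forall w, w ∈ W -> a <> k w /\ a <> k' w) /\ b = a)).

Lemma swap_disjoint (w w' : M) : w ∈ W -> w' ∈ W -> k w <> k' w'.
Proof.
  intros Hw Hw' E. apply (embeds_off _ _ _ Hk' w' Hw'). rewrite <- E.
  apply cup_spec. right. apply img_spec; [exact Dk|]. eauto.
Qed.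

Lemma swap_l (w : M) : w ∈ W -> swap (k w) = k' w.
Proof.
  intros Hw. apply the_eq; [left; eauto|].
  intros z [(v & Hv & E & ->)|[(v & Hv & E & ->)|[N _]]].
  - apply (embeds_inj _ _ _ Hk) in E; [subst; reflexivity|assumption|assumption].
  - destruct (swap_disjoint w v Hw Hv E).
  - destruct (N w Hw) as [N' _]. destruct (N' eq_refl).
Qed.

Lemma swap_r (w : M) : w ∈ W -> swap (k' w) = k w.
Proof.
  intros Hw. apply the_eq; [right; left; eauto|].
  intros z [(v & Hv & E & ->)|[(v & Hv & E & ->)|[N _]]].
  - destruct (swap_disjoint v w Hv Hw (eq_sym E)).
  - apply (embeds_inj _ _ _ Hk') in E; [subst; reflexivity|assumption|assumption].
  - destruct (N w Hw) as [_ N']. destruct (N' eq_refl).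
Qed.

Lemma swap_id (a : M) : (forall w, w ∈ W -> a <> k w /\ a <> k' w) -> swap a = a.
Proof.
  intros Ha. apply the_eq; [right; right; auto|].
  intros z [(v & Hv & E & ->)|[(v & Hv & E & ->)|[N ->]]]; [..|reflexivity].
  - destruct (Ha v Hv) as [N _]. destruct (N E).
  - destruct (Ha v Hv) as [_ N]. destruct (N E).
Qed.

Lemma swap_cases (a : M) : (exists w, w ∈ W /\ a = k w) \/ (exists w, w ∈ W /\ a = k' w) \/
  (forall w, w ∈ W -> a <> k w /\ a <> k' w).
Proof.
  destruct (classic (exists w, w ∈ W /\ a = k w)) as [|N]; [auto|].
  destruct (classic (exists w, w ∈ W /\ a = k' w)) as [|N']; [auto|].
  right. right. intros w Hw. split; intros E; [apply N|apply N']; eauto.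
Qed.

Lemma swap_swap (a : M) : swap (swap a) = a.
Proof.
  destruct (swap_cases a) as [(w & Hw & ->)|[(w & Hw & ->)|N]].
  - rewrite swap_l, swap_r; auto.
  - rewrite swap_r, swap_l; auto.
  - rewrite !(swap_id a); auto.
Qed.

Lemma swap_ur (a : M) : ur a -> ur (swap a).
Proof.
  destruct (swap_cases a) as [(w & Hw & ->)|[(w & Hw & ->)|N]]; intros U.
  - rewrite swap_l by exact Hw. apply Hk', Hw.
  - rewrite swap_r by exact Hw. apply Hk, Hw.
  - rewrite swap_id; assumption.
Qed.

Definition swap_aut (x : M) : M :=
  rec (fun _ x i => the (fun y => (ur x /\ y = swap x) \/ (is_set x /\ y = i))) empty x.

Lemma swap_aut_dt : definable_fun1 swap_aut.
Proof.
  assert (D2 : definable_fun2 (rec (fun _ x i => the (fun y => (ur x /\ y = swap x) \/ (is_set x /\ y = i))))).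
  { apply dt2_rec. unfold swap. dfn. }
  unfold swap_aut. dfn.
Qed.

Lemma swap_aut_eq (x : M) :
  swap_aut x = the (fun y => (ur x /\ y = swap x) \/ (is_set x /\ y = img x swap_aut)).
Proof. unfold swap_aut at 1. rewrite rec_eq by (unfold swap; dfn). reflexivity. Qed.

Lemma swap_aut_ur (x : M) : ur x -> swap_aut x = swap x.
Proof.
  intros U. rewrite swap_aut_eq. apply the_eq; [auto|].
  intros z [[_ H]|[H _]]; [exact H|destruct (H U)].
Qed.

Lemma swap_aut_set (x : M) : is_set x -> swap_aut x = img x swap_aut.
Proof.
  intros U. rewrite swap_aut_eq. apply the_eq; [auto|].
  intros z [[H _]|[_ H]]; [destruct (U H)|exact H].
Qed.

Lemma swap_aut_mem (x y : M) : x ∈ y -> swap_aut x ∈ swap_aut y.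
Proof.
  intros H. rewrite (swap_aut_set y (has_mem_set y x H)).
  apply img_spec; [apply swap_aut_dt|eauto].
Qed.

Lemma swap_aut_invol : forall x, swap_aut (swap_aut x) = x.
Proof.
  pose proof swap_aut_dt as DS.
  apply mem_induction; [dfn|].
  intros x IH. destruct (classic (ur x)) as [U|Sx].
  - rewrite (swap_aut_ur x U), swap_aut_ur by (apply swap_ur, U). apply swap_swap.
  - rewrite (swap_aut_set x Sx).
    rewrite swap_aut_set by (apply img_spec, DS).
    apply set_ext; [apply img_spec, DS|exact Sx|]. intros z. rewrite (proj2 (img_spec _ _ DS)). split.
    + intros (u & Hu & ->). apply img_spec in Hu; [|exact DS]. destruct Hu as (v & Hv & ->).
      rewrite IH; assumption.
    + intros Hz. exists (swap_aut z). rewrite IH by exact Hz. split; [|reflexivity].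
      apply img_spec; eauto.
Qed.

Lemma swap_is_aut : aut swap_aut swap_aut.
Proof.
  assert (U : forall x, ur x -> ur (swap_aut x)).
  { intros x U. rewrite swap_aut_ur by exact U. apply swap_ur, U. }
  constructor; auto using swap_aut_dt, swap_aut_invol, swap_aut_mem.
Qed.

Lemma swap_aut_fixes (a : M) : ur a -> a ∈ D -> swap_aut a = a.
Proof.
  intros U Ha. rewrite swap_aut_ur by exact U. apply swap_id. intros w Hw. split; intros ->.
  - exact (embeds_off _ _ _ Hk w Hw Ha).
  - apply (embeds_off _ _ _ Hk' w Hw). apply cup_spec. auto.
Qed.

Lemma swap_aut_l (w : M) : w ∈ W -> swap_aut (k w) = k' w.
Proof. intros Hw. rewrite swap_aut_ur by apply Hk, Hw. apply swap_l, Hw. Qed.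

Lemma swap_aut_r (w : M) : w ∈ W -> swap_aut (k' w) = k w.
Proof. intros Hw. rewrite swap_aut_ur by apply Hk', Hw. apply swap_r, Hw. Qed.

End Swap.

(** * Interchangeable urelements *)

Context (PL : Plenitude_plus M).

Lemma plenitude_inj (x : M) : is_set x -> exists f,
  (forall u, u ∈ x -> ur (ap f u)) /\
  (forall u u', u ∈ x -> u' ∈ x -> ap f u = ap f u' -> u = u').
Proof.
  intros Sx. destruct (PL x Sx) as (A & _ & HA & f & [[[_ [Hf1 Hf2]] _] Inj]).
  exists f.
  assert (E : forall u, u ∈ x -> app f u (ap f u)).
  { intros u Hu. apply app_opair. apply (the_spec (fun v => opair u v ∈ f)).
    destruct (Hf2 u Hu) as (v & Hv & Uv). exists v. split; [apply app_opair, Hv|].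
    intros v' Hv'. apply Uv, app_opair, Hv'. }
  split.
  - intros u Hu. apply HA. pose proof (proj1 (app_opair _ _ _) (E u Hu)) as H.
    destruct (Hf1 _ H) as (u' & v' & _ & Hv' & H'). apply is_opair_opair, opair_inj in H'.
    destruct H' as [_ ->]. exact Hv'.
  - intros u u' Hu Hu' Eq. apply (Inj u u' (ap f u)); [apply E, Hu|]. rewrite Eq. apply E, Hu'.
Qed.

(** Plenitude⁺ gives a copy of [W × K] for [K] the double power set of [D]. If each
    column [W × {k}] met [D], the traces of the columns on [D] would be disjoint and
    nonempty, and [k ↦ s k] would inject [K = P(P(D))] into [P(D)], against Cantor.
    So some column is a copy of [W] off [D]. *)
Lemma fresh_copy (W D : M) : exists g, embeds (ap g) W D.
Proof.
  set (K := pow (pow D)).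
  destruct (plenitude_inj (prod W K) (proj1 (prod_spec _ _))) as (f & Uf & If).
  set (s := fun k => sep D (fun a => exists w, w ∈ W /\ a = ap f (opair w k))).
  assert (Dsk : forall k, definable1 (fun a => exists w, w ∈ W /\ a = ap f (opair w k))) by (intros k; dfn).
  assert (Ds : definable_fun1 s) by (unfold s; dfn).
  destruct (classic (exists k, k ∈ K /\ forall w, w ∈ W -> ~ ap f (opair w k) ∈ D)) as [(k & Hk & N)|N].
  - assert (Dg : definable_fun1 (fun w => ap f (opair w k))) by dfn.
    exists (graph W (fun w => ap f (opair w k))). constructor.
    + intros w Hw. rewrite ap_graph by assumption. apply Uf, opair_prod. auto.
    + intros w Hw. rewrite ap_graph by assumption. apply N, Hw.
    + intros w w' Hw Hw'. rewrite !ap_graph by assumption. intros E.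
      apply If in E; [|apply opair_prod; auto..]. apply opair_inj in E. apply E.
  - exfalso.
    assert (Inj : forall k k', k ∈ K -> k' ∈ K -> s k = s k' -> k = k').
    { intros k k' Hk Hk' E. apply NNPP. intros Nk. apply N. exists k. split; [exact Hk|].
      intros w Hw Ha. assert (H : ap f (opair w k) ∈ s k) by (apply sep_spec; eauto).
      rewrite E in H. apply sep_spec in H; [|apply Dsk]. destruct H as (_ & w' & Hw' & H).
      apply If in H; [|apply opair_prod; auto..]. apply opair_inj in H. apply Nk, H. }
    assert (DQ : definable1 (fun r => exists k, k ∈ K /\ r = s k /\ ~ r ∈ k)) by dfn.
    (* Cantor's diagonal set: [s k ∈ k] if and only if it is not. *)
    set (k := sep (pow D) (fun r => exists k, k ∈ K /\ r = s k /\ ~ r ∈ k)).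
    assert (Hk : k ∈ K).
    { apply pow_spec. split; [apply sep_spec, DQ|]. intros r Hr. apply sep_spec in Hr; [apply Hr|exact DQ]. }
    assert (N1 : ~ s k ∈ k).
    { intros H. pose proof H as H0. apply sep_spec in H0; [|exact DQ].
      destruct H0 as (_ & k' & Hk' & E & N'). apply Inj in E; [|assumption..]. subst k'. exact (N' H). }
    apply N1. apply sep_spec; [exact DQ|]. split; [|eauto].
    apply pow_spec. split; [apply sep_spec, Dsk|]. intros r Hr. apply sep_spec in Hr; [apply Hr|apply Dsk].
Qed.

Lemma dt1_ap (g : M) : definable_fun1 (ap g).
Proof. dfn. Qed.

Lemma embeds_weaken (k : M -> M) (W D W' D' : M) : embeds k W D -> W' ⊆ W -> D' ⊆ D -> embeds k W' D'.
Proof.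
  intros [H1 H2 H3] HW HD. constructor; auto. intros w Hw H. exact (H2 w (HW w Hw) (HD _ H)).
Qed.

(** The two copies may overlap, so both are exchanged with a third one that is
    disjoint from them and from [D]. *)
Lemma homogeneity (k k' : M -> M) (W D : M) : definable_fun1 k -> definable_fun1 k' -> atoms D ->
  embeds k W D -> embeds k' W D -> exists σ τ, aut σ τ /\
    (forall a, a ∈ D -> σ a = a) /\ forall w, w ∈ W -> σ (k w) = k' w.
Proof.
  intros Dk Dk' HD Hk Hk'.
  destruct (fresh_copy W (cup (cup D (img W k)) (cup D (img W k')))) as (g & Hg).
  pose proof (dt1_ap g) as Dg.
  assert (Hg1 : embeds (ap g) W (cup D (img W k))).
  { apply (embeds_weaken _ _ _ _ _ Hg); [intros z Hz; exact Hz|]. intros z Hz. apply cup_spec. auto. }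
  assert (Hg2 : embeds (ap g) W (cup D (img W k'))).
  { apply (embeds_weaken _ _ _ _ _ Hg); [intros z Hz; exact Hz|]. intros z Hz. apply cup_spec. auto. }
  pose proof (aut_comp _ _ _ _ (swap_is_aut _ _ _ _ Dk Dg Hk Hg1) (swap_is_aut _ _ _ _ Dk' Dg Hk' Hg2)) as Ha.
  eexists _, _. split; [exact Ha|]. split; cbv beta.
  - intros a Ha'. rewrite (swap_aut_fixes k (ap g) W D); auto. apply (swap_aut_fixes k' (ap g) W D); auto.
  - intros w Hw. rewrite (swap_aut_l k (ap g) W D); auto. apply (swap_aut_r k' (ap g) W D); auto.
Qed.

(** * Measuring sets by ordinals *)

Context (S0 : M) (HS : SVC_for S0).

Definition code (a : M) : M := pow (prod S0 a).
(** The factor [a] makes the index sets grow by a disjoint copy of [code c] when [c]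
    is added to the ordinal: this is the room into which new urelements are moved. *)
Definition index (a : M) : M := prod a (code a).
Definition stage (A g a : M) : M := level (cup A (img (index a) (ap g))) a.
Definition coded (B a : M) : Prop := exists h,
  (forall b, b ∈ B -> ap h b ∈ code a) /\
  forall b b', b ∈ B -> b' ∈ B -> ap h b = ap h b' -> b = b'.

Lemma dt1_index : definable_fun1 index.
Proof. unfold index, code. dfn. Qed.

Ltac dfn_extra ::= first
  [ simple apply (dfn_app1 ord dfn_ord) | simple apply (dt_app2 level dt2_level)
  | simple apply (dt_app1 index dt1_index) ].

Lemma dt2_stage (A : M) : definable_fun2 (stage A).
Proof. unfold stage. dfn. Qed.

Lemma dfn2_coded : definable2 coded.
Proof. unfold coded, code. dfn. Qed.

Lemma dfn2_embeds (A : M) : definable2 (fun g a => embeds (ap g) (index a) A).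
Proof.
  apply (dfn_ext (fun e => (forall w, w ∈ index (e 1) -> ur (ap (e 0) w)) /\
    (forall w, w ∈ index (e 1) -> ~ ap (e 0) w ∈ A) /\
    (forall w w', w ∈ index (e 1) -> w' ∈ index (e 1) -> ap (e 0) w = ap (e 0) w' -> w = w'))).
  - intros e. split; [intros (? & ? & ?); constructor; assumption|intros [? ? ?]; auto].
  - dfn.
Qed.

Lemma code_mono (a b : M) : a ⊆ b -> code a ⊆ code b.
Proof.
  intros H x Hx. apply pow_spec in Hx. apply pow_spec. destruct Hx as [Sx Hx]. split; [exact Sx|].
  intros z Hz. apply Hx, prod_spec in Hz. destruct Hz as (u & v & Hu & Hv & ->).
  apply opair_prod. auto.
Qed.

Lemma index_mono (a b : M) : a ⊆ b -> index a ⊆ index b.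
Proof.
  intros H x Hx. apply prod_spec in Hx. destruct Hx as (u & v & Hu & Hv & ->).
  apply opair_prod. split; [auto|exact (code_mono a b H v Hv)].
Qed.

Lemma mem_support (A g W y : M) :
  y ∈ cup A (img W (ap g)) <-> y ∈ A \/ exists w, w ∈ W /\ y = ap g w.
Proof. rewrite (proj2 (cup_spec _ _)), (proj2 (img_spec _ _ (dt1_ap g))). tauto. Qed.

Lemma stage_mono (A g a b : M) : a ⊆ b -> stage A g a ⊆ stage A g b.
Proof.
  intros H. apply level_mono; [|exact H]. intros y Hy. apply mem_support. apply mem_support in Hy.
  destruct Hy as [|(w & Hw & E)]; [auto|]. right. exists w. split; [exact (index_mono a b H w Hw)|exact E].
Qed.

Lemma coded_mono (B a b : M) : a ⊆ b -> coded B a -> coded B b.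
Proof.
  intros H (h & H1 & H2). exists h. split; [|exact H2]. intros z Hz. exact (code_mono a b H _ (H1 z Hz)).
Qed.

(** A surjection [f] from [S0 × a] onto [B] sends the points of [B] to their fibres,
    which are distinct. *)
Lemma svc_coded (B : M) : is_set B -> exists a, ord a /\ coded B a.
Proof.
  intros SB. destruct (HS B SB) as (a & p & Oa & Hp & Hs). apply is_ordinal_ord in Oa.
  apply is_product_prod in Hp. subst p. exists a. split; [exact Oa|].
  destruct Hs as [(f & [_ [Hf1 Hf2]] & Hf3)|[_ N]].
  - assert (Df : forall b, definable1 (fun q => opair q b ∈ f)) by (intros b; dfn).
    assert (Dh : definable_fun1 (fun b => sep (prod S0 a) (fun q => opair q b ∈ f))) by dfn.
    exists (graph B (fun b => sep (prod S0 a) (fun q => opair q b ∈ f))). split.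
    + intros b Hb. rewrite ap_graph by assumption. apply pow_spec. split; [apply sep_spec, Df|].
      intros z Hz. apply sep_spec in Hz; [apply Hz|apply Df].
    + intros b b' Hb Hb'. rewrite !ap_graph by assumption. intros E.
      destruct (Hf3 b Hb) as (q & Hq). pose proof Hq as Hq'. apply app_opair in Hq'.
      destruct (Hf1 _ Hq') as (u & v & Hu & _ & Huv). apply is_opair_opair, opair_inj in Huv.
      destruct Huv as [<- _].
      assert (H : q ∈ sep (prod S0 a) (fun q => opair q b ∈ f)) by (apply sep_spec; auto).
      rewrite E in H. apply sep_spec in H; [|apply Df]. destruct H as [_ H]. apply app_opair in H.
      destruct (Hf2 q Hu) as (v' & _ & Uv). rewrite <- (Uv b Hq). apply Uv, H.
  - exists empty. split; [intros b Hb|intros b b' Hb]; destruct (N b Hb).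
Qed.

(** * Bounding witnesses *)

Definition agree (n : nat) (e e' : env) : Prop := forall i, i < n -> e i = e' i.

(** [ord_bound] for finite tuples of parameters, which are handled one at a time so
    that tuples need not be coded in the model. *)
Lemma ord_bound_env (n : nat) (T : M) : forall P : env -> M -> Prop,
  definable (fun e => P (fun i => e (S i)) (e 0)) ->
  (forall e a b, ord a -> ord b -> a ⊆ b -> P e a -> P e b) ->
  (forall e e' a, agree n e e' -> P e a -> P e' a) ->
  (forall e, (forall i, i < n -> e i ∈ T) -> exists a, ord a /\ P e a) ->
  exists a, ord a /\ forall e, (forall i, i < n -> e i ∈ T) -> P e a.
Proof.
  induction n as [|n IH]; intros P DP Up Loc H.
  - destruct (H (fun _ => empty)) as (a & Oa & Ha); [intros i Hi; lia|].
    exists a. split; [exact Oa|]. intros e _. apply (Loc (fun _ => empty)); [|exact Ha]. intros i Hi; lia.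
  - destruct (IH (fun e a => forall x, x ∈ T -> P (x .: e) a)) as (a & Oa & Ha).
    + apply dfn_all, dfn_imp; [dfn|].
      apply (dfn_ext (fun e => P (fun i => e (match i with O => O | S j => S (S j) end)) (e 1))).
      * intros e. replace (fun i => e match i with O => O | S j => S (S j) end)
          with (e 0 .: fun i => e (S (S i))); [reflexivity|].
        extensionality i; destruct i; reflexivity.
      * exact (dfn_rename _ (fun i => match i with O => 1 | S O => O | S (S j) => S (S j) end) DP).
    + intros e a b Oa Ob Hab Ha x Hx. exact (Up _ a b Oa Ob Hab (Ha x Hx)).
    + intros e e' a Hee Ha x Hx. apply (Loc (x .: e)); [|exact (Ha x Hx)].
      intros [|i] Hi; simpl; [reflexivity|]. apply Hee. lia.
    + intros e He. apply (ord_bound T (fun x a => P (x .: e) a)).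
      * apply (dfn_ext (fun E => P (fun i => match i with O => E 0 | S j => e j end) (E 1))).
        -- intros E. replace (fun i => match i with O => E 0 | S j => e j end) with (E 0 .: e); [reflexivity|].
           extensionality i; destruct i; reflexivity.
        -- apply (dfn_ext (fun E => P (fun i => slot (fun i => match i with O => inl 1 | S O => inl 0
             | S (S j) => inr (e j) end) E (S i)) (slot (fun i => match i with O => inl 1 | S O => inl 0
             | S (S j) => inr (e j) end) E 0))).
           ++ intros E. unfold slot at 2.
              replace (fun i => slot (fun i => match i with O => inl 1 | S O => inl 0
             | S (S j) => inr (e j) end) E (S i)) with (fun i => match i with O => E 0 | S j => e j end); [reflexivity|].
              extensionality i; destruct i; reflexivity.
           ++ exact (dfn_inst _ _ DP).
      * intros x a b. apply Up.
      * intros x Hx. apply H. intros [|i] Hi; simpl; [exact Hx|]. apply He. lia.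
    + exists a. split; [exact Oa|]. intros e He.
      apply (Loc (e 0 .: fun i => e (S i))); [intros [|i] _; reflexivity|].
      apply Ha; [|apply He; lia]. intros i Hi. apply He. lia.
Qed.

Definition append (n : nat) (e' e : env) : env := fun i => if i <? n then e' i else e (i - n).

(** Quantification over whole environments is first-order when only finitely many
    entries matter: it is a block of [n] quantifiers. *)
Lemma dfn_all_env (n : nat) : forall (T : env -> M) (Q : env -> Prop), definable_term T -> definable Q ->
  definable (fun e => forall e', (forall i, i < n -> e' i ∈ T e) -> Q (append n e' e)).
Proof.
  induction n as [|n IH]; intros T Q DT DQ.
  - apply (dfn_ext Q); [|exact DQ]. intros e.
    assert (E : forall e', append 0 e' e = e).
    { intros e'. extensionality i. unfold append. simpl. f_equal. lia. }
    split; [intros H e' _; rewrite E; exact H|].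
    intros H. rewrite <- (E e). apply H. intros i Hi; lia.
  - apply (dfn_ext (fun e => forall x, x ∈ T e ->
      forall e', (forall i, i < n -> e' i ∈ T e) -> Q (append n e' (x .: e)))).
    + intros e. split.
      * intros H e' He'.
        replace (append (S n) e' e) with (append n e' (e' n .: e)); [apply H; auto|].
        extensionality i. unfold append.
        destruct (Nat.ltb_spec i n), (Nat.ltb_spec i (S n)); try lia; try reflexivity.
        -- replace i with n by lia. rewrite Nat.sub_diag. reflexivity.
        -- replace (i - n) with (S (i - S n)) by lia. reflexivity.
      * intros H x Hx e' He'.
        specialize (H (fun i => if i <? n then e' i else x)).
        replace (append n e' (x .: e)) with (append (S n) (fun i => if i <? n then e' i else x) e).
        -- apply H. intros i Hi. destruct (Nat.ltb_spec i n); auto.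
        -- extensionality i. unfold append.
           destruct (Nat.ltb_spec i n), (Nat.ltb_spec i (S n)); try lia; try reflexivity.
           ++ replace i with n by lia. rewrite Nat.sub_diag. reflexivity.
           ++ replace (i - n) with (S (i - S n)) by lia. reflexivity.
    + apply dfn_all, dfn_imp; [apply dfn_mem; [apply dt_var|apply dt_weaken, DT]|].
      apply (dfn_ext (fun e => forall e', (forall i, i < n -> e' i ∈ T (fun i => e (S i))) -> Q (append n e' e))).
      * intros e. replace (e 0 .: fun i => e (S i)) with e; [reflexivity|].
        extensionality i; destruct i; reflexivity.
      * apply IH; [apply dt_weaken, DT|exact DQ].
Qed.

Fixpoint bound (p : formula) : nat :=
  match p with
  | fEq i j | fMem i j => S (max i j)
  | fUr i => S i
  | fBot => 0
  | fImp p q => max (bound p) (bound q)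
  | fAll p => pred (bound p)
  end.

Lemma free_bound (p : formula) : forall i, free i p -> i < bound p.
Proof.
  induction p as [j k|j k|j| |p IHp q IHq|p IHp]; intros i H; simpl in *; try lia.
  - destruct H as [H|H]; [apply IHp in H|apply IHq in H]; lia.
  - apply IHp in H. lia.
Qed.

(** [fAll] is the only quantifier, so the existential statements that need witnesses
    are those asserting that [fAll p] fails. *)
Definition refuted (e : env) (p : formula) (y : M) : Prop := ~ sat (y .: e) p.

Lemma refuted_agree (p : formula) (e e' : env) (y : M) :
  agree (bound (fAll p)) e e' -> refuted e p y -> refuted e' p y.
Proof.
  intros H N Hs. apply N. apply (sat_ext p (y .: e')); [|exact Hs].
  intros [|i] Hi; simpl; [reflexivity|]. symmetry. apply H, (free_bound (fAll p)), Hi.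
Qed.

Lemma refuted_aut (σ τ : M -> M) (p : formula) (e : env) (y : M) : aut σ τ ->
  refuted e p y -> refuted (fun i => σ (e i)) p (σ y).
Proof.
  intros Hσ N Hs. apply N, (sat_aut σ τ Hσ).
  replace (fun i => σ ((y .: e) i)) with (σ y .: fun i => σ (e i)); [exact Hs|].
  extensionality i; destruct i; reflexivity.
Qed.

Lemma dfn_refuted (p : formula) : definable (fun e => refuted (fun i => e (S i)) p (e 0)).
Proof.
  apply dfn_not. apply (dfn_ext (fun e => sat e p)); [|apply dfn_sat].
  intros e. replace (e 0 .: fun i => e (S i)) with e; [reflexivity|].
  extensionality i; destruct i; reflexivity.
Qed.

(** Quantifying over all families [g], and not fixing one, makes this a relation
    between ordinals that can be iterated before any family is chosen. *)
Definition witnesses_bounded (A : M) (p : formula) (a b : M) : Prop :=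
  forall g, embeds (ap g) (index b) A ->
  forall e, (forall i, i < bound (fAll p) -> e i ∈ stage A g a) ->
  (exists y, refuted e p y) -> exists y, y ∈ stage A g b /\ refuted e p y.

Lemma dfn2_witnesses_bounded (A : M) (p : formula) : definable2 (witnesses_bounded A p).
Proof.
  pose proof (dfn2_embeds A) as DE. pose proof (dt2_stage A) as DS.
  pose proof (dfn_refuted p) as DR.
  set (n := bound (fAll p)).
  apply dfn_all, dfn_imp; [exact (dfn_app2 _ DE _ _ (dt_var 0) (dt_var 2))|].
  apply (dfn_ext (fun e => forall e', (forall i, i < n -> e' i ∈ stage A (e 0) (e 1)) ->
    (exists y, refuted (append n e' e) p y) ->
    exists y, y ∈ stage A (append n e' e n) (append n e' e (S (S n))) /\ refuted (append n e' e) p y)).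
  - intros e.
    assert (E0 : forall e' k, append n e' e (k + n) = e k).
    { intros e' k. unfold append. destruct (Nat.ltb_spec (k + n) n); [lia|]. f_equal. lia. }
    assert (E1 : forall e', append n e' e n = e 0) by (intros e'; exact (E0 e' 0)).
    assert (E2 : forall e', append n e' e (S (S n)) = e 2) by (intros e'; exact (E0 e' 2)).
    assert (Ag : forall e', agree n (append n e' e) e').
    { intros e' i Hi. unfold append. destruct (Nat.ltb_spec i n); [reflexivity|lia]. }
    assert (Ag' : forall e', agree n e' (append n e' e)) by (intros e' i Hi; symmetry; apply Ag, Hi).
    split; intros H e' He' (y & Hy).
    + destruct (H e' He') as (z & Hz & Rz).
      * exists y. exact (refuted_agree p _ _ y (Ag' e') Hy).
      * rewrite E1, E2 in Hz. exists z. split; [exact Hz|exact (refuted_agree p _ _ z (Ag e') Rz)].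
    + destruct (H e' He') as (z & Hz & Rz).
      * exists y. exact (refuted_agree p _ _ y (Ag e') Hy).
      * rewrite E1, E2. exists z. split; [exact Hz|exact (refuted_agree p _ _ z (Ag' e') Rz)].
  - apply (dfn_all_env n (fun e => stage A (e 0) (e 1)) (fun e => (exists y, refuted e p y) ->
      exists y, y ∈ stage A (e n) (e (S (S n))) /\ refuted e p y)); [exact DS|].
    apply dfn_imp; apply dfn_ex; [exact DR|]. apply dfn_and; [dfn|exact DR].
Qed.

Lemma witnesses_bounded_up (A : M) (p : formula) (a b c : M) : b ⊆ c -> witnesses_bounded A p a b -> witnesses_bounded A p a c.
Proof.
  intros H G g Hg e He Hy. destruct (G g) with (e := e) as (y & Hy1 & Hy2); auto.
  - apply (embeds_weaken _ _ _ _ _ Hg (index_mono b c H)). intros z Hz; exact Hz.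
  - exists y. split; [exact (stage_mono A g b c H y Hy1)|exact Hy2].
Qed.

Lemma witnesses_bounded_down (A : M) (p : formula) (a b c : M) : b ⊆ a -> witnesses_bounded A p a c -> witnesses_bounded A p b c.
Proof.
  intros H G g Hg e He. apply (G g Hg). intros i Hi. exact (stage_mono A g b a H _ (He i Hi)).
Qed.

Lemma ord_max (a b : M) : ord a -> ord b -> exists c, ord c /\ a ⊆ c /\ b ⊆ c.
Proof.
  intros Oa Ob. destruct (ord_total a b Oa Ob) as [H|H].
  - exists b. split; [exact Ob|]. split; [exact H|intros z Hz; exact Hz].
  - exists a. split; [exact Oa|]. split; [intros z Hz; exact Hz|exact (ord_mem_subset a b Oa H)].
Qed.

Lemma atoms_support (A g W : M) : atoms A -> (forall w, w ∈ W -> ur (ap g w)) ->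
  atoms (cup A (img W (ap g))).
Proof.
  intros HA Hg x Hx. apply mem_support in Hx. destruct Hx as [Hx|(w & Hw & ->)]; auto.
Qed.

(** Any object lies in a level over [D] and a set of additional urelements, and one
    ordinal bounds both its rank and the size of that set. *)
Lemma witness_split (D y : M) : exists B c, ord c /\ y ∈ level (cup D B) c /\
  (forall b, b ∈ B -> ur b /\ ~ b ∈ D) /\ coded B c.
Proof.
  destruct (level_cover y) as (A & a & HA & Oa & Hy).
  assert (DD : definable1 (fun b => ~ b ∈ D)) by dfn.
  set (B := sep A (fun b => ~ b ∈ D)).
  destruct (svc_coded B) as (c & Oc & Hc); [apply sep_spec, DD|].
  destruct (ord_max a c Oa Oc) as (d & Od & Had & Hcd).
  exists B, d. split; [exact Od|]. split; [|split].
  - apply (level_mono A (cup D B) a d); [|exact Had|exact Hy].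
    intros z Hz. apply cup_spec. destruct (classic (z ∈ D)) as [|N]; [auto|].
    right. apply sep_spec; auto.
  - intros b Hb. apply sep_spec in Hb; [|exact DD]. destruct Hb. auto.
  - exact (coded_mono B c d Hcd Hc).
Qed.

(** A bound [c0] is found for one auxiliary family [g0]. Given another family [g], the
    automorphism [σ] carries the values of [g] on [index a] to those of [g0]; the
    witness found there is pulled back by its inverse [τ]. Its additional urelements
    form a set [B2] that injects into [code c], so [ρ] can move them onto values of [g]
    at [{c} × code c] while fixing the support of the parameters, and hence the
    parameters. *)
Lemma witnesses_bounded_total (A : M) (p : formula) (a : M) : atoms A -> ord a ->
  exists b, ord b /\ witnesses_bounded A p a b.
Proof.
  intros HA Oa.
  destruct (fresh_copy (index a) A) as (g0 & Hg0).
  set (D0 := cup A (img (index a) (ap g0))).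
  destruct (ord_bound_env (bound (fAll p)) (stage A g0 a) (fun e c => (exists y, refuted e p y) ->
    exists y B, refuted e p y /\ y ∈ level (cup D0 B) c /\
      (forall b, b ∈ B -> ur b /\ ~ b ∈ D0) /\ coded B c)) as (c0 & Oc0 & Hc0).
  - apply dfn_imp; [apply dfn_ex; exact (dfn_rename _ (fun i => match i with O => O | S j => S (S j) end) (dfn_refuted p))|].
    pose proof dfn2_coded as DC.
    apply dfn_ex, dfn_ex, dfn_and; [|dfn].
    exact (dfn_rename _ (fun i => match i with O => 1 | S j => S (S (S j)) end) (dfn_refuted p)).
  - intros e c d _ _ Hcd H Hy. destruct (H Hy) as (y & B & H1 & H2 & H3 & H4).
    exists y, B. split; [exact H1|]. split; [exact (level_mono_ord _ c d Hcd y H2)|].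
    split; [exact H3|exact (coded_mono B c d Hcd H4)].
  - intros e e' c He H (y0 & Hy0).
    assert (He' : agree (bound (fAll p)) e' e) by (intros i Hi; symmetry; apply He, Hi).
    destruct H as (y & B & H1 & H2); [exists y0; exact (refuted_agree p _ _ y0 He' Hy0)|].
    exists y, B. split; [exact (refuted_agree p _ _ y He H1)|exact H2].
  - intros e He. destruct (classic (exists y, refuted e p y)) as [(y & Hy)|N].
    + destruct (witness_split D0 y) as (B & c & Oc & H). exists c. split; [exact Oc|].
      intros _. exists y, B. split; assumption.
    + exists empty. split; [apply ord_empty|]. intros Hy. destruct (N Hy).
  - destruct (ord_max a c0 Oa Oc0) as (c & Oc & Hac & Hc0c).
    (* [succ c] is the least ordinal for which the index set has a layer at [c]. *)
    exists (succ c). split; [apply ord_succ, Oc|].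
    intros g Hg e He (y0 & Hy0).
    assert (Hcs : c ∈ succ c) by (apply succ_spec; auto).
    assert (Hc' : c ⊆ succ c) by (intros z Hz; apply succ_spec; auto).
    assert (Hga : embeds (ap g) (index a) A).
    { apply (embeds_weaken _ _ _ _ _ Hg); [|intros z Hz; exact Hz].
      apply index_mono. intros z Hz. apply Hc', Hac, Hz. }
    set (D := cup A (img (index a) (ap g))).
    assert (HD : atoms D) by (apply atoms_support; [exact HA|apply Hga]).
    destruct (homogeneity (ap g) (ap g0) (index a) A (dt1_ap g) (dt1_ap g0) HA Hga Hg0)
      as (σ & τ & Hσ & Fσ & Mσ).
    assert (σD : forall x, x ∈ D -> σ x ∈ D0).
    { intros x Hx. apply mem_support in Hx. apply mem_support. destruct Hx as [Hx|(w & Hw & ->)].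
      - rewrite Fσ by exact Hx. auto.
      - rewrite Mσ by exact Hw. eauto. }
    assert (τD : forall x, x ∈ D0 -> τ x ∈ D).
    { intros x Hx. apply mem_support in Hx. apply mem_support. destruct Hx as [Hx|(w & Hw & ->)].
      - left. rewrite <- (Fσ x Hx), (aut_inv_l σ τ Hσ). exact Hx.
      - right. exists w. rewrite <- (Mσ w Hw), (aut_inv_l σ τ Hσ). auto. }
    destruct (Hc0 (fun i => σ (e i))) as (y & B & Ry & Ly & HB & h & Hh1 & Hh2).
    { intros i Hi. exact (level_aut σ τ D D0 Hσ σD a _ (He i Hi)). }
    { exists (σ y0). apply (refuted_aut σ τ); assumption. }
    pose proof (aut_dt σ τ Hσ) as Dσ. pose proof (aut_dt_inv σ τ Hσ) as Dτ.
    set (B2 := img B τ).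
    assert (HB2 : forall b, b ∈ B2 -> σ b ∈ B).
    { intros b Hb. apply img_spec in Hb; [|exact Dτ]. destruct Hb as (b0 & Hb0 & ->).
      rewrite (aut_inv_r σ τ Hσ). exact Hb0. }
    assert (Eid : embeds (fun b => b) B2 D).
    { constructor; auto.
      - intros b Hb. rewrite <- (aut_inv_l σ τ Hσ b). apply (aut_ur_inv σ τ Hσ), HB, HB2, Hb.
      - intros b Hb Hb'. exact (proj2 (HB _ (HB2 b Hb)) (σD b Hb')). }
    set (k := fun b => ap g (opair c (ap h (σ b)))).
    assert (Dk : definable_fun1 k) by (unfold k; dfn).
    assert (Ik : forall b, b ∈ B2 -> opair c (ap h (σ b)) ∈ index (succ c)).
    { intros b Hb. apply opair_prod. split; [exact Hcs|].
      apply (code_mono c0 (succ c)); [intros z Hz; apply Hc', Hc0c, Hz|]. apply Hh1, HB2, Hb. }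
    assert (Ek : embeds k B2 D).
    { constructor.
      - intros b Hb. apply Hg, Ik, Hb.
      - intros b Hb Hb'. apply mem_support in Hb'. destruct Hb' as [H|(w & Hw & H)].
        + exact (embeds_off _ _ _ Hg _ (Ik b Hb) H).
        + (* The new layer at [c] avoids [index a], since [c ∈ a ⊆ c] is impossible. *)
          apply (embeds_inj _ _ _ Hg) in H; [|apply Ik, Hb|].
          * subst w. apply opair_prod in Hw. destruct (mem_irrefl c). apply Hac, Hw.
          * apply (index_mono a (succ c)); [|exact Hw]. intros z Hz. apply Hc', Hac, Hz.
      - intros b b' Hb Hb' H. apply (embeds_inj _ _ _ Hg) in H; [|apply Ik; assumption..].
        apply opair_inj in H. destruct H as [_ H]. apply Hh2 in H; [|apply HB2; assumption..].
        rewrite <- (aut_inv_l σ τ Hσ b), H. apply (aut_inv_l σ τ Hσ). }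
    assert (Did : definable_fun1 (fun b => b)) by dfn.
    destruct (homogeneity (fun b => b) k B2 D Did Dk HD Eid Ek) as (ρ & ρ' & Hρ & Fρ & Mρ).
    exists (ρ (τ y)). split.
    + apply (level_mono (cup A (img (index (succ c)) (ap g))) _ c0 (succ c));
        [intros z Hz; exact Hz|intros z Hz; apply Hc', Hc0c, Hz|].
      apply (level_aut ρ ρ' (cup D B2)); [exact Hρ| |].
      * intros x Hx. apply mem_support. apply cup_spec in Hx. destruct Hx as [Hx|Hx].
        -- rewrite Fρ by exact Hx. apply mem_support in Hx. destruct Hx as [Hx|(w & Hw & E)]; [auto|].
           right. exists w. split; [|exact E].
           apply (index_mono a (succ c)); [|exact Hw]. intros z Hz. apply Hc', Hac, Hz.
        -- right. rewrite Mρ by exact Hx. exists (opair c (ap h (σ x))). split; [apply Ik, Hx|reflexivity].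
      * apply (level_aut τ σ (cup D0 B)); [apply aut_sym, Hσ| |exact Ly].
        intros x Hx. apply cup_spec. apply cup_spec in Hx. destruct Hx as [Hx|Hx]; [auto|].
        right. apply img_spec; [exact Dτ|eauto].
    + apply (refuted_agree p (fun i => ρ (τ (σ (e i))))).
      * intros i Hi. rewrite (aut_inv_l σ τ Hσ).
        apply (level_fixed ρ ρ' D Hρ Fρ a). exact (He i Hi).
      * apply (refuted_aut ρ ρ' p (fun i => τ (σ (e i)))); [exact Hρ|].
        apply (refuted_aut τ σ p (fun i => σ (e i))); [apply aut_sym, Hσ|exact Ry].
Qed.

Fixpoint all_witnesses_bounded (A : M) (p : formula) (a b : M) : Prop :=
  match p with
  | fImp p q => all_witnesses_bounded A p a b /\ all_witnesses_bounded A q a b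
  | fAll p => witnesses_bounded A p a b /\ all_witnesses_bounded A p a b
  | _ => True
  end.

Lemma dfn2_all_witnesses_bounded (A : M) (p : formula) : definable2 (all_witnesses_bounded A p).
Proof.
  induction p; try exact (dfn_const True); apply dfn_and; auto; apply dfn2_witnesses_bounded.
Qed.

Lemma all_witnesses_bounded_up (A : M) (p : formula) (a b c : M) : b ⊆ c -> all_witnesses_bounded A p a b -> all_witnesses_bounded A p a c.
Proof.
  intros H. induction p; simpl; try tauto. pose proof (witnesses_bounded_up A p a b c H). tauto.
Qed.

Lemma all_witnesses_bounded_down (A : M) (p : formula) (a b c : M) : b ⊆ a -> all_witnesses_bounded A p a c -> all_witnesses_bounded A p b c.
Proof.
  intros H. induction p; simpl; try tauto. pose proof (witnesses_bounded_down A p a b c H). tauto.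
Qed.

Lemma all_witnesses_bounded_total (A : M) (p : formula) (a : M) : atoms A -> ord a ->
  exists b, ord b /\ all_witnesses_bounded A p a b.
Proof.
  intros HA Oa.
  induction p as [i j|i j|i| |p (b & Ob & Hb) q (c & Oc & Hc)|p (b & Ob & Hb)]; simpl;
    try (exists a; tauto).
  - destruct (ord_max b c Ob Oc) as (d & Od & H1 & H2). exists d. split; [exact Od|].
    split; [exact (all_witnesses_bounded_up A p a b d H1 Hb)|exact (all_witnesses_bounded_up A q a c d H2 Hc)].
  - destruct (witnesses_bounded_total A p a HA Oa) as (c & Oc & Hc).
    destruct (ord_max b c Ob Oc) as (d & Od & H1 & H2). exists d. split; [exact Od|].
    split; [exact (witnesses_bounded_up A p a c d H2 Hc)|exact (all_witnesses_bounded_up A p a b d H1 Hb)].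
Qed.

(** Recursion inside the model gives an increasing sequence of ordinals [s n] such that
    the least ordinal related to [s n] is an element of [s (n+1)]. Its supremum over ω
    is closed because [R] is inherited by smaller first arguments. *)
Lemma closed_ordinal (R : M -> M -> Prop) (a0 : M) : definable2 R -> ord a0 ->
  (forall a b c, b ⊆ a -> R a c -> R b c) ->
  (forall a, ord a -> exists b, ord b /\ R a b) ->
  exists l, ord l /\ a0 ∈ l /\ forall a, a ∈ l -> exists b, b ∈ l /\ R a b.
Proof.
  intros DR Oa0 Down Tot.
  destruct omega_exists as (w & _ & _ & W0 & WS).
  set (F := fun a => least (R a)).
  assert (DRa : forall a, definable1 (R a)) by (intros a; dfn).
  assert (DF : definable_fun1 F) by (unfold F, least; dfn).
  assert (HF : forall a, ord a -> ord (F a) /\ R a (F a)).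
  { intros a Oa. destruct (least_spec (R a) (DRa a) (Tot a Oa)) as (H1 & H2 & _). auto. }
  assert (DsF : definable_fun1 (fun a => succ (F a))) by dfn.
  set (G := fun _ _ i : M => cup (succ a0) (union (img i (fun a => succ (F a))))).
  assert (DG : definable_fun3 G) by (unfold G; dfn).
  set (s := rec G empty).
  assert (Ds : definable_fun1 s) by (pose proof (dt2_rec G DG); unfold s; dfn).
  assert (Hs : forall n x, x ∈ s n <-> x ∈ succ a0 \/ exists m, m ∈ n /\ x ∈ succ (F (s m))).
  { intros n x. unfold s at 1. rewrite rec_eq by exact DG. fold s. unfold G at 1.
    rewrite (proj2 (cup_spec _ _)), (proj2 (union_spec _)).
    assert (E : (exists y, y ∈ img (img n s) (fun a => succ (F a)) /\ x ∈ y) <->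
      exists m, m ∈ n /\ x ∈ succ (F (s m))); [|rewrite E; tauto].
    split.
    - intros (y & Hy & Hx). apply img_spec in Hy; [|exact DsF]. destruct Hy as (u & Hu & ->).
      apply img_spec in Hu; [|exact Ds]. destruct Hu as (m & Hm & ->). eauto.
    - intros (m & Hm & Hx). exists (succ (F (s m))). split; [|exact Hx].
      apply img_spec; [exact DsF|]. exists (s m). split; [|reflexivity].
      apply img_spec; [exact Ds|eauto]. }
  assert (Os : forall n, ord (s n)).
  { apply mem_induction; [dfn|]. intros n IH. unfold s. rewrite rec_eq by exact DG. fold s. unfold G at 1.
    assert (OU : ord (union (img (img n s) (fun a => succ (F a))))).
    { apply ord_union. intros a Ha. apply img_spec in Ha; [|exact DsF]. destruct Ha as (u & Hu & ->).
      apply img_spec in Hu; [|exact Ds]. destruct Hu as (m & Hm & ->).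
      apply ord_succ, HF, IH, Hm. }
    destruct (ord_max _ _ (ord_succ a0 Oa0) OU) as (d & Od & H1 & H2).
    split; [apply cup_spec|]. split.
    - intros y z Hy Hz. apply cup_spec. apply cup_spec in Hy. destruct Hy as [Hy|Hy].
      + left. exact (ord_mem_subset _ y (ord_succ a0 Oa0) Hy z Hz).
      + right. exact (ord_mem_subset _ y OU Hy z Hz).
    - intros y Hy. apply Od. apply cup_spec in Hy. destruct Hy; auto. }
  exists (union (img w s)). split; [|split].
  - apply ord_union. intros a Ha. apply img_spec in Ha; [|exact Ds]. destruct Ha as (n & _ & ->). apply Os.
  - apply union_spec. exists (s empty). split; [apply img_spec; [exact Ds|eauto]|].
    apply Hs. left. apply succ_spec. auto.
  - intros a Ha. apply union_spec in Ha. destruct Ha as (v & Hv & Ha).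
    apply img_spec in Hv; [|exact Ds]. destruct Hv as (n & Hn & ->).
    exists (F (s n)). split.
    + apply union_spec. exists (s (succ n)). split; [apply img_spec; [exact Ds|eauto]|].
      apply Hs. right. exists n. split; apply succ_spec; auto.
    + apply (Down (s n)); [exact (ord_mem_subset _ a (Os n) Ha)|apply HF, Os].
Qed.

(** * Reflection *)

Fixpoint tarski_vaught (t : M) (p : formula) : Prop :=
  match p with
  | fImp p q => tarski_vaught t p /\ tarski_vaught t q
  | fAll p => (forall e, (forall i, free (S i) p -> e i ∈ t) ->
      (exists y, refuted e p y) -> exists y, y ∈ t /\ refuted e p y) /\ tarski_vaught t p
  | _ => True
  end.

(** The environment [e'] is [e] with [t] inserted at index [k], which is how
    [relativize k] reads its variables. *)
Lemma tarski_vaught_reflects (t : M) (p : formula) : tarski_vaught t p -> forall k (e e' : env),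
  (forall i, free i p -> e i ∈ t) -> e' k = t -> (forall i, e' (lift k i) = e i) ->
  (sat e p <-> sat e' (relativize k p)).
Proof.
  induction p as [i j|i j|i| |p IHp q IHq|p IHp]; simpl; intros TV k e e' He Ht E.
  - rewrite !E. tauto.
  - rewrite !E. tauto.
  - rewrite !E. tauto.
  - tauto.
  - rewrite (IHp (proj1 TV) k e e'), (IHq (proj2 TV) k e e'); auto; tauto.
  - destruct TV as [TV1 TV2].
    assert (IH : forall x, x ∈ t -> (sat (x .: e) p <-> sat (x .: e') (relativize (S k) p))).
    { intros x Hx. apply IHp; [exact TV2| |exact Ht|].
      - intros [|i] Hi; simpl; auto.
      - intros [|i]; [reflexivity|]. unfold lift in *. simpl.
        change (S i <? S k) with (i <? k). specialize (E i).
        destruct (i <? k); exact E. }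
    split.
    + intros H x Hx. rewrite Ht in Hx. apply IH; auto.
    + intros H. apply NNPP. intros N.
      destruct (TV1 e He) as (y & Hy & Ny).
      * apply NNPP. intros N'. apply N. intros x. apply NNPP. intros N2. apply N'. exists x. exact N2.
      * apply Ny, IH; [exact Hy|]. apply H. rewrite Ht. exact Hy.
Qed.

(** The union in [reflection] is over the stages, not one level over the union of their
    bases: each finite tuple then lies in a single stage below [l]. *)
Lemma common_stage (A g l : M) (n : nat) (e : env) : ord l -> empty ∈ l ->
  (forall i, i < n -> exists a, a ∈ l /\ e i ∈ stage A g a) ->
  exists a, a ∈ l /\ forall i, i < n -> e i ∈ stage A g a.
Proof.
  intros Ol H0. induction n as [|n IH]; intros H.
  - exists empty. split; [exact H0|]. intros i Hi; lia.
  - destruct IH as (a & Ha & Ea); [intros i Hi; apply H; lia|].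
    destruct (H n) as (b & Hb & Eb); [lia|].
    assert (C : exists c, c ∈ l /\ a ⊆ c /\ b ⊆ c).
    { destruct (ord_total a b (ord_mem l a Ol Ha) (ord_mem l b Ol Hb)) as [C|C].
      - exists b. split; [exact Hb|]. split; [exact C|intros z Hz; exact Hz].
      - exists a. split; [exact Ha|]. split; [intros z Hz; exact Hz|].
        exact (ord_mem_subset a b (ord_mem l a Ol Ha) C). }
    destruct C as (c & Hc & Hac & Hbc). exists c. split; [exact Hc|]. intros i Hi.
    destruct (Nat.eq_dec i n) as [->|Ne].
    + exact (stage_mono A g b c Hbc _ Eb).
    + apply (stage_mono A g a c Hac). apply Ea. lia.
Qed.

Lemma reflection (p : formula) (x : M) : exists t, is_set t /\ transitive t /\ x ∈ t /\ tarski_vaught t p.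
Proof.
  destruct (level_cover x) as (A & a0 & HA & Oa0 & Hx).
  destruct (closed_ordinal (all_witnesses_bounded A p) a0 (dfn2_all_witnesses_bounded A p) Oa0) as (l & Ol & Ha0 & Hl).
  { intros a b c. apply all_witnesses_bounded_down. }
  { intros a Oa. apply all_witnesses_bounded_total; assumption. }
  destruct (fresh_copy (index l) A) as (g & Hg).
  assert (Dst : definable_fun1 (stage A g)) by (pose proof (dt2_stage A); dfn).
  set (t := union (img l (stage A g))).
  assert (Ht : forall y, y ∈ t <-> exists a, a ∈ l /\ y ∈ stage A g a).
  { intros y. unfold t. rewrite (proj2 (union_spec _)). split.
    - intros (v & Hv & Hy). apply img_spec in Hv; [|exact Dst]. destruct Hv as (a & Ha & ->). eauto.
    - intros (a & Ha & Hy). exists (stage A g a). split; [apply img_spec; [exact Dst|eauto]|exact Hy]. }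
  assert (Hgl : forall a, a ∈ l -> embeds (ap g) (index a) A).
  { intros a Ha. apply (embeds_weaken _ _ _ _ _ Hg); [|intros z Hz; exact Hz].
    apply index_mono, ord_mem_subset; assumption. }
  assert (Hxt : x ∈ t).
  { apply Ht. exists a0. split; [exact Ha0|]. apply (level_mono A _ a0 a0); [|intros z Hz; exact Hz|exact Hx].
    intros z Hz. apply mem_support. auto. }
  assert (H0 : empty ∈ l).
  { destruct (ord_total l empty Ol ord_empty) as [H|H]; [|exact H].
    destruct (proj2 empty_spec a0 (H a0 Ha0)). }
  exists t. split; [apply union_spec|]. split; [|split; [exact Hxt|]].
  - intros y z Hy Hz. apply Ht in Hy. destruct Hy as (a & Ha & Hy). apply Ht. exists a. split; [exact Ha|].
    apply (level_transitive (cup A (img (index a) (ap g))) a) with (y := y); [|exact (ord_mem l a Ol Ha)|exact Hy|exact Hz].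
    apply atoms_support; [exact HA|]. apply (Hgl a Ha).
  - assert (TV : forall q, (forall a, a ∈ l -> exists b, b ∈ l /\ witnesses_bounded A q a b) ->
      forall e, (forall i, free (S i) q -> e i ∈ t) ->
      (exists y, refuted e q y) -> exists y, y ∈ t /\ refuted e q y).
    { intros q Hq e He (y & Hy).
      (* Entries of the environment that do not occur in [q] are replaced by [x], to
         make all entries elements of [t]. *)
      set (e1 := fun i => if excluded_middle_informative (free (S i) q) then e i else x).
      assert (He1 : forall i, e1 i ∈ t).
      { intros i. unfold e1. destruct (excluded_middle_informative (free (S i) q)); auto. }
      assert (R1 : forall z, refuted e q z <-> refuted e1 q z).
      { intros z. unfold refuted. rewrite (sat_ext q (z .: e) (z .: e1)); [tauto|].
        intros [|i] Hi; simpl; [reflexivity|]. unfold e1.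
        destruct (excluded_middle_informative (free (S i) q)); tauto. }
      destruct (common_stage A g l (bound (fAll q)) e1 Ol H0) as (a & Ha & Ea).
      { intros i _. apply Ht, He1. }
      destruct (Hq a Ha) as (b & Hb & Gb).
      destruct (Gb g (Hgl b Hb) e1 Ea) as (z & Hz & Rz); [exists y; apply R1, Hy|].
      exists z. split; [apply Ht; eauto|apply R1, Rz]. }
    clear - Hl TV. induction p as [i j|i j|i| |p IHp q IHq|p IHp]; simpl; try exact I.
    + split; [apply IHp|apply IHq]; intros a Ha; destruct (Hl a Ha) as (b & Hb & H); exists b;
        (split; [exact Hb|apply H]).
    + split; [apply TV|apply IHp]; intros a Ha; destruct (Hl a Ha) as (b & Hb & H); exists b;
        (split; [exact Hb|apply H]).
Qed.

End Model.

Theorem theorem3 (M : structure) (HZFU : ZFU M) (HSVC : SVC M) :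
  Plenitude_plus M -> RP M.
Proof.
  intros PL p x _. destruct HSVC as (s & _ & Hs).
  destruct (reflection M HZFU PL s Hs p x) as (t & St & Tt & Hx & TV).
  exists t. split; [exact St|]. split; [exact Tt|]. split; [intros z Hz; exact (Tt x z Hx Hz)|].
  intros e He. apply (tarski_vaught_reflects M t p TV 0); auto.
Qed.
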